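(* Suppose the linear program has a unique primal optimal solution $x^\star$ and a unique dual optimal solution $(y^\star,s^\star)$, and suppose $Ac=0$. Run rPDHG with step sizes $\tau=\frac1{2\kappa}$, $\sigma=\frac1{2\lambda_{\max}\lambda_{\min}}$ and restart parameter $\beta=1/e$. Let $T_1$ be the total number of OnePDHG iterations required to obtain $z^{N_1,0}$, where $N_1$ is the first outer index such that for all $N\ge N_1$ the positive components of $x^{N,0}$ correspond exactly to the optimal basis, i.e. $\{i:x^{N,0}_i>0\}=\Theta$. Then $$T_1\le T_{basis},\qquad T_{basis}=O\left(\kappa\Phi\cdot\ln(\kappa\Phi)\right).$$ Furthermore, for $\varepsilon>0$ let $T_2$ be the total number of OnePDHG iterations required to obtain the first outer iterate $N_2$ for which $w^{N_2,0}$ is $\varepsilon$-optimal. Then $$T_2\le T_{basis}+T_{local},\qquad T_{local}=O\left(\|B^{-1}\|\,\|A\|\cdot\max\left\{0,\ \ln\left(\frac{\min_{1\le i\le n}\{x_i^\star+s_i^\star\}}{\varepsilon}\right)\right\}\right).$$ Here $T_{basis}$ does not depend on $\varepsilon$, and each $O(\cdot)$ hides only an absolute constant (independent of $m,n,A,b,c,\varepsilon$).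
   Context: **LP setting.** $1\le m<n$, $A\in\mathbb{R}^{m\times n}$ has linearly independent rows, $b\in\mathbb{R}^m$, $c\in\mathbb{R}^n$. Primal: $\min\{c^\top x: Ax=b,\ x\ge 0\}$. Dual: $\max\{b^\top y: A^\top y+s=c,\ s\ge 0\}$. The LP is feasible and bounded. When the primal and dual optimal solutions $x^\star$ and $(y^\star,s^\star)$ are unique, the optimal basis $\Theta=\{i:x^\star_i>0\}$ has exactly $m$ elements and its complement is $\{i:s_i^\star>0\}$; variables are ordered so that $\Theta=\{1,\dots,m\}$, and $A=(B\ \ N)$ with $B\in\mathbb{R}^{m\times m}$ (nonsingular) and $N\in\mathbb{R}^{m\times(n-m)}$. Write $w^\star=(x^\star,s^\star)$. $\|\cdot\|$ is the Euclidean norm for vectors and the spectral norm for matrices; $M_{\cdot,j}$ and $M_{i,\cdot}$ are the $j$th column and $i$th row of a matrix $M$. **Condition numbers.** $\lambda_{\max}$ and $\lambda_{\min}$ are the largest and smallest nonzero singular values of $A$, $\kappa=\lambda_{\max}/\lambda_{\min}$, and $$\Phi:=(\|x^\star\|_1+\|s^\star\|_1)\cdot\max\left\{\max_{1\le j\le n-m}\frac{\sqrt{\|(B^{-1}N)_{\cdot,j}\|^2+1}}{s^\star_{m+j}},\ \max_{1\le i\le m}\frac{\sqrt{\|(B^{-1}N)_{i,\cdot}\|^2+1}}{x^\star_i}\right\}.$$ **Algorithm (rPDHG).** Let $L(x,y)=c^\top x+b^\top y-(Ax)^\top y$ on $\mathbb{R}^n_+\times\mathbb{R}^m$ (minimized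 in $x$, maximized in $y$). For step sizes $\tau,\sigma>0$, one OnePDHG iteration maps $(x,y)$ to $(x',y')$ with $x'=(x-\tau(c-A^\top y))^+$ (componentwise positive part) and $y'=y+\sigma(b-A(2x'-x))$. Start from $z^{0,0}=(0,0)$. In outer loop $\ell=0,1,2,\dots$: for $k=0,1,2,\dots$ set $z^{\ell,k+1}=\text{OnePDHG}(z^{\ell,k})$ and $\bar z^{\ell,k+1}=\frac1{k+1}\sum_{i=1}^{k+1}z^{\ell,i}$; stop the inner loop at the first $k\ge1$ for which the $\beta$-restart condition holds for $\bar z^{\ell,k}$, and set $z^{\ell+1,0}=\bar z^{\ell,k}$. The algorithm terminates if some $z^{\ell,0}$ is a saddle point of $L$; statements about outer iterates concern those that are generated. With $M=\begin{pmatrix}\frac1\tau I_n&-A^\top\\-A&\frac1\sigma I_m\end{pmatrix}$ and $\|z\|_M=\sqrt{z^\top Mz}$, the normalized duality gap at $z=(x,y)$ with radius $r>0$ is $$\rho(r;z)=\frac1r\sup\{L(x,\hat y)-L(\hat x,y):\ (\hat x,\hat y)\in\mathbb{R}^n_+\times\mathbb{R}^m,\ \|(\hat x,\hat y)-z\|_M\le r\}.$$ The $\beta$-restart condition ($\beta\in(0,1)$) holds for $\bar z^{\ell,k}$ if and only if either $\ell=0$ and $k=1$, or $\ell\ge1$ and $\rho(\|\bar z^{\ell,k}-z^{\ell,0}\|_M;\bar z^{\ell,k})\le\beta\,\rho(\|z^{\ell,0}-z^{\ell-1,0}\|_M;z^{\ell,0})$. **$\varepsilon$-optimality and notation.** For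 $z^{\ell,0}=(x^{\ell,0},y^{\ell,0})$ put $w^{\ell,0}=(x^{\ell,0},c-A^\top y^{\ell,0})$. $w=(x,s)$ is $\varepsilon$-optimal if its Euclidean distance to the set of optimal pairs (here $\{w^\star\}$) is at most $\varepsilon$. Iterations are counted in total over all outer loops. *)

(* Defs.v *)
From mathcomp Require Import all_boot all_order all_algebra.
From mathcomp Require Import all_classical all_reals all_analysis.

Set Implicit Arguments.
Unset Strict Implicit.
Unset Printing Implicit Defensive.

Import Order.TTheory GRing.Theory Num.Theory.

Local Open Scope classical_set_scope.
Local Open Scope ring_scope.

Section Norms.
Context {R : realType}.

(* The norm [`|v|] that MathComp-Analysis puts on matrices is the sup norm. *)
Definition norm2 (m n : nat) (M : 'M[R]_(m, n)) : R :=
  Num.sqrt (\sum_i \sum_j M i j ^+ 2).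

Definition norm1 (n : nat) (v : 'cV[R]_n) : R := \sum_i `|v i 0|.

Definition spectral_norm (m n : nat) (M : 'M[R]_(m, n)) : R :=
  sup [set norm2 (M *m v) | v in [set v : 'cV[R]_n | norm2 v <= 1]].

Definition nonzero_singular_value (m n : nat) (M : 'M[R]_(m, n)) : set R :=
  [set s | 0 < s /\ eigenvalue (M^T *m M) (s ^+ 2)].

Definition lambda_max (m n : nat) (M : 'M[R]_(m, n)) : R :=
  sup (nonzero_singular_value M).

Definition lambda_min (m n : nat) (M : 'M[R]_(m, n)) : R :=
  inf (nonzero_singular_value M).

Definition kappa (m n : nat) (M : 'M[R]_(m, n)) : R :=
  lambda_max M / lambda_min M.

End Norms.

Section LP.
Context {R : realType} {m n : nat}.
Variables (A : 'M[R]_(m, n)) (b : 'cV[R]_m) (c : 'cV[R]_n).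

Definition nonneg (k : nat) (v : 'cV[R]_k) : Prop := forall i, 0 <= v i 0.

Definition dotp (k : nat) (u v : 'cV[R]_k) : R := (u^T *m v) 0 0.

Definition primal_feasible (x : 'cV[R]_n) : Prop := A *m x = b /\ nonneg x.

Definition primal_optimal (x : 'cV[R]_n) : Prop :=
  primal_feasible x /\
  forall x', primal_feasible x' -> dotp c x <= dotp c x'.

Definition dual_feasible (ys : 'cV[R]_m * 'cV[R]_n) : Prop :=
  A^T *m ys.1 + ys.2 = c /\ nonneg ys.2.

Definition dual_optimal (ys : 'cV[R]_m * 'cV[R]_n) : Prop :=
  dual_feasible ys /\
  forall ys', dual_feasible ys' -> dotp b ys'.1 <= dotp b ys.1.

Definition unique_primal_optimal (x : 'cV[R]_n) : Prop :=
  primal_optimal x /\ forall x', primal_optimal x' -> x' = x.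

Definition unique_dual_optimal (ys : 'cV[R]_m * 'cV[R]_n) : Prop :=
  dual_optimal ys /\ forall ys', dual_optimal ys' -> ys' = ys.

Definition pos_support (x : 'cV[R]_n) : {set 'I_n} := [set i | 0 < x i 0]%SET.

Definition optimal_pairs : set ('cV[R]_n * 'cV[R]_n) :=
  [set w | primal_optimal w.1 /\ exists y, dual_optimal (y, w.2)].

Definition dist_pairs (w w' : 'cV[R]_n * 'cV[R]_n) : R :=
  norm2 (col_mx (w.1 - w'.1) (w.2 - w'.2)).

Definition eps_optimal (eps : R) (w : 'cV[R]_n * 'cV[R]_n) : Prop :=
  inf [set dist_pairs w w' | w' in optimal_pairs] <= eps.

End LP.

Section RPDHG.
Context {R : realType} {m n : nat}.
Variables (A : 'M[R]_(m, n)) (b : 'cV[R]_m) (c : 'cV[R]_n).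
Variables (tau sigma beta : R).

Let pd := ('cV[R]_n * 'cV[R]_m)%type.

Definition lagrangian (x : 'cV[R]_n) (y : 'cV[R]_m) : R :=
  dotp c x + dotp b y - dotp (A *m x) y.

Definition saddle_point (z : pd) : Prop :=
  nonneg z.1 /\
  (forall y, lagrangian z.1 y <= lagrangian z.1 z.2) /\
  (forall x, nonneg x -> lagrangian z.1 z.2 <= lagrangian x z.2).

Definition pos_part (v : 'cV[R]_n) : 'cV[R]_n := \col_i Num.max (v i 0) 0.

Definition onePDHG (z : pd) : pd :=
  let x' := pos_part (z.1 - tau *: (c - A^T *m z.2)) in
  (x', z.2 + sigma *: (b - A *m (2 *: x' - z.1))).

Definition Mmx : 'M[R]_(n + m) :=
  block_mx (tau^-1)%:M (- A^T) (- A) (sigma^-1)%:M.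

Definition normM (z : pd) : R :=
  Num.sqrt (dotp (col_mx z.1 z.2) (Mmx *m col_mx z.1 z.2)).

Definition rho (r : R) (z : pd) : R :=
  r^-1 * sup [set lagrangian z.1 zh.2 - lagrangian zh.1 z.2
             | zh in [set zh : pd | nonneg zh.1 /\ normM (zh - z) <= r]].

(* The average of the k iterates that follow z; z itself is not included. *)
Definition average (z : pd) (k : nat) : pd :=
  k%:R^-1 *: \sum_(1 <= i < k.+1) iter i onePDHG z.

(* [z0] is the starting point of outer loop [l], and [zprev] that of outer
   loop [l - 1] (irrelevant when [l = 0]). *)
Definition restart_condition (l : nat) (zprev z0 : pd) (k : nat) : Prop :=
  (l = 0%N /\ k = 1%N) \/
  ((1 <= l)%N /\
   rho (normM (average z0 k - z0)) (average z0 k)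
     <= beta * rho (normM (z0 - zprev)) z0).

Definition first_restart (l : nat) (zprev z0 : pd) (k : nat) : Prop :=
  (1 <= k)%N /\ restart_condition l zprev z0 k /\
  forall j, (1 <= j < k)%N -> ~ restart_condition l zprev z0 j.

(* [rPDHG_run l zprev z T]: the algorithm generates the outer iterate
   z^{l,0} = z, after T calls to OnePDHG in total, and z^{l-1,0} = zprev
   (with the dummy value 0 when l = 0). *)
Inductive rPDHG_run : nat -> pd -> pd -> nat -> Prop :=
| rPDHG_start : rPDHG_run 0 0 0 0
| rPDHG_restart l zprev z T k :
    rPDHG_run l zprev z T -> ~ saddle_point z -> first_restart l zprev z k ->
    rPDHG_run l.+1 z (average z k) (T + k).

Definition outer_iterate (l : nat) (z : pd) (T : nat) : Prop :=
  exists zprev, rPDHG_run l zprev z T.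

Definition basis_identified_from (Theta : {set 'I_n}) (N0 : nat) : Prop :=
  forall N z T, (N0 <= N)%N -> outer_iterate N z T -> pos_support z.1 = Theta.

Definition first_basis_iterate (Theta : {set 'I_n}) (N1 T1 : nat) : Prop :=
  (exists z, outer_iterate N1 z T1) /\
  basis_identified_from Theta N1 /\
  forall N, (N < N1)%N -> ~ basis_identified_from Theta N.

Definition outer_eps_optimal (eps : R) (z : pd) : Prop :=
  eps_optimal A b c eps (z.1, c - A^T *m z.2).

Definition first_eps_iterate (eps : R) (N2 T2 : nat) : Prop :=
  (exists z, outer_iterate N2 z T2 /\ outer_eps_optimal eps z) /\
  forall N z T, (N < N2)%N -> outer_iterate N z T -> ~ outer_eps_optimal eps z.

End RPDHG.

Section Condition.
Context {R : realType} {m p : nat}.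
Variables (A : 'M[R]_(m, m + p)) (xs ss : 'cV[R]_(m + p)).

Definition basis_mx : 'M[R]_m := lsubmx A.
Definition nonbasis_mx : 'M[R]_(m, p) := rsubmx A.

(* When x* and s* are positive on the basic and nonbasic indices respectively,
   all the quotients are positive and the default value 0 of the maxima is
   immaterial. *)
Definition Phi : R :=
  let D := invmx basis_mx *m nonbasis_mx in
  (norm1 xs + norm1 ss) *
  Num.max
    (\big[Num.max/0]_(j < p)
       (Num.sqrt (norm2 (col j D) ^+ 2 + 1) / ss (rshift m j) 0))
    (\big[Num.max/0]_(i < m)
       (Num.sqrt (norm2 (row i D) ^+ 2 + 1) / xs (lshift p i) 0)).

Definition min_xs : R := inf (range (fun i => xs i 0 + ss i 0)).

End Condition.

(* Main.v *)
Require Import Defs.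
From mathcomp Require Import all_boot all_order all_algebra.
From mathcomp Require Import all_classical all_reals all_analysis.
From mathcomp Require Import ring lra.

(** PDHG is a proximal point iteration, so the distance to the saddle point in
the corresponding norm never increases and the duality gap of the average of [K]
iterates is [O(1/K)] times a squared distance. A restart thus happens as soon as
[K] exceeds a constant times any [L] such that [dist <= L * rho] holds at the
starting point of the loop.

Uniqueness makes [B] invertible, with [x*] and [s*] positive exactly on [B] and
[N]. The differences [x - x*] and [s - s*] are combinations of the columns
of [(-D; 1)] and of the rows of [(1, D)], where [D = B^-1 N], with coefficients
controlled by the terms [x_j s*_j] and [|s_i| x*_i] of the gap at a suitable
test point; this gives [L = O(kappa Phi)] everywhere. Once the distance is small
compared with [1 / mu], where [Phi = (|x*|_1 + |s*|_1) mu], the projection step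
sets [x_N = 0] exactly. From then on only [B x_B] and [B^T y] matter, and
[L = O(|B^-1| |A|)]. The normalized gap decreases by the factor [e] in each
loop, so [O(ln (kappa Phi))] loops reach this regime.

The norm in [rho] uses the matrix [Mmx], in which the sign of [A] is opposite
to that of the proximal norm of the iteration. The two norms are within a
factor [2] of each other, which costs only constants. *)

Set Implicit Arguments.
Unset Strict Implicit.
Unset Printing Implicit Defensive.

Import Order.TTheory GRing.Theory Num.Theory.
Local Open Scope ring_scope.

(** * Semidefinite forms and Euclidean norms *)

Section SemidefiniteForm.
Context {R : realType} {V : lmodType R}.
Variable f : V -> V -> R.
Hypotheses (fDl : forall u v w, f (u + v) w = f u w + f v w)
  (fZl : forall t u v, f (t *: u) v = t * f u v)
  (fC : forall u v, f u v = f v u) (f_ge0 : forall u, 0 <= f u u).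

Definition form_norm (u : V) : R := Num.sqrt (f u u).

Lemma form_normK u : form_norm u ^+ 2 = f u u.
Proof. exact: sqr_sqrtr (f_ge0 u). Qed.

Lemma form_norm_ge0 u : 0 <= form_norm u. Proof. exact: sqrtr_ge0. Qed.

Lemma form_sqrDZ s t u v :
  f (s *: u + t *: v) (s *: u + t *: v) =
  s ^+ 2 * f u u + 2 * s * t * f u v + t ^+ 2 * f v v.
Proof.
rewrite fDl [f (s *: u) _]fC [f (t *: v) _]fC !fDl !fZl.
by rewrite [f u (s *: u)]fC [f v (s *: u)]fC [f u (t *: v)]fC [f v (t *: v)]fC
  !fZl [f v u]fC; ring.
Qed.

Lemma form_sqrD u v : f (u + v) (u + v) = f u u + 2 * f u v + f v v.
Proof.
by have := form_sqrDZ 1 1 u v; rewrite !scale1r => ->; rewrite expr1n; ring.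
Qed.

(** The form is nonnegative at [f v v *: u - f u v *: v], which settles the case [f v v != 0]. As
    the form is only semidefinite, [f v v = 0] needs its own argument. *)
Lemma form_CauchySchwarz_sqr u v : f u v ^+ 2 <= f u u * f v v.
Proof.
have [fv0|fv_gt0] := eqVneq (f v v) 0; last first.
  have := f_ge0 (f v v *: u + (- f u v) *: v); rewrite form_sqrDZ.
  have -> : f v v ^+ 2 * f u u + 2 * f v v * - f u v * f u v +
    (- f u v) ^+ 2 * f v v = f v v * (f u u * f v v - f u v ^+ 2) by ring.
  by rewrite pmulr_rge0 ?subr_ge0 // lt_def fv_gt0 f_ge0.
have [->|fuv0] := eqVneq (f u v) 0; first by rewrite fv0 mulr0 expr0n.
(* With [f v v = 0] the form is affine along [v]; this multiple of [v] would bring its value to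
   [-1]. *)
have := f_ge0 (1 *: u + (- (f u u + 1) / (2 * f u v)) *: v).
rewrite form_sqrDZ fv0.
have -> : 1 ^+ 2 * f u u + 2 * 1 * (- (f u u + 1) / (2 * f u v)) * f u v +
  (- (f u u + 1) / (2 * f u v)) ^+ 2 * 0 = -1 by field.
by rewrite oppr_ge0 ler10.
Qed.

Lemma form_CauchySchwarz u v : f u v <= form_norm u * form_norm v.
Proof.
apply: le_trans (ler_norm _) _.
rewrite -(ler_pXn2r (n := 2)) ?nnegrE ?mulr_ge0 ?form_norm_ge0 //.
by rewrite real_normK ?num_real // exprMn !form_normK form_CauchySchwarz_sqr.
Qed.

Lemma form_normD u v : form_norm (u + v) <= form_norm u + form_norm v.
Proof.
rewrite -(ler_pXn2r (n := 2)) ?nnegrE ?addr_ge0 ?form_norm_ge0 //.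
rewrite form_normK form_sqrD sqrrD !form_normK.
by have := form_CauchySchwarz u v; lra.
Qed.

Lemma form_normZ t u : form_norm (t *: u) = `|t| * form_norm u.
Proof.
by rewrite /form_norm fZl fC fZl mulrA -expr2 sqrtrM ?sqr_ge0 // sqrtr_sqr.
Qed.

Lemma form_normN u : form_norm (- u) = form_norm u.
Proof. by rewrite -scaleN1r form_normZ normrN1 mul1r. Qed.

Lemma form_norm0 : form_norm 0 = 0.
Proof. by rewrite -(scale0r 0) form_normZ normr0 mul0r. Qed.

Lemma form_norm_distC u v : form_norm (u - v) = form_norm (v - u).
Proof. by rewrite -opprB form_normN. Qed.

Lemma form_norm_sum I (r : seq I) (F : I -> V) :
  form_norm (\sum_(i <- r) F i) <= \sum_(i <- r) form_norm (F i).
Proof.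
elim: r => [|i r IHr]; first by rewrite !big_nil form_norm0.
by rewrite !big_cons; apply: le_trans (form_normD _ _) _; rewrite lerD2l.
Qed.

End SemidefiniteForm.

Section Euclid.
Context {R : realType}.
Implicit Types k m n : nat.

Lemma dotpE k (u v : 'cV[R]_k) : dotp u v = \sum_i u i 0 * v i 0.
Proof. by rewrite /dotp mxE; apply: eq_bigr => i _; rewrite mxE. Qed.

Lemma dotpC k (u v : 'cV[R]_k) : dotp u v = dotp v u.
Proof. by rewrite !dotpE; apply: eq_bigr => i _; rewrite mulrC. Qed.

Lemma dotpDl k (u v w : 'cV[R]_k) : dotp (u + v) w = dotp u w + dotp v w.
Proof. by rewrite /dotp linearD mulmxDl mxE. Qed.

Lemma dotpZl k t (u v : 'cV[R]_k) : dotp (t *: u) v = t * dotp u v.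
Proof. by rewrite /dotp linearZ -scalemxAl mxE. Qed.

Lemma dotpDr k (u v w : 'cV[R]_k) : dotp w (u + v) = dotp w u + dotp w v.
Proof. by rewrite !(dotpC w) dotpDl. Qed.

Lemma dotpZr k t (u v : 'cV[R]_k) : dotp v (t *: u) = t * dotp v u.
Proof. by rewrite !(dotpC v) dotpZl. Qed.

Lemma dotpNl k (u v : 'cV[R]_k) : dotp (- u) v = - dotp u v.
Proof. by rewrite -scaleN1r dotpZl mulN1r. Qed.

Lemma dotpNr k (u v : 'cV[R]_k) : dotp v (- u) = - dotp v u.
Proof. by rewrite !(dotpC v) dotpNl. Qed.

Lemma dotp0l k (v : 'cV[R]_k) : dotp 0 v = 0.
Proof. by rewrite -(scale0r 0) dotpZl mul0r. Qed.

Lemma dotp0r k (v : 'cV[R]_k) : dotp v 0 = 0.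
Proof. by rewrite dotpC dotp0l. Qed.

Definition dotpB := (dotpDl, dotpDr, dotpNl, dotpNr).

Lemma dotp_mull m n (M : 'M[R]_(m, n)) (u : 'cV_n) (v : 'cV_m) :
  dotp (M *m u) v = dotp u (M^T *m v).
Proof. by rewrite /dotp trmx_mul mulmxA. Qed.

Lemma dotp_ge0 k (u : 'cV[R]_k) : 0 <= dotp u u.
Proof. by rewrite dotpE sumr_ge0 // => i _; rewrite -expr2 sqr_ge0. Qed.

Lemma dotp_col_mx k1 k2 (u u' : 'cV[R]_k1) (v v' : 'cV[R]_k2) :
  dotp (col_mx u v) (col_mx u' v') = dotp u u' + dotp v v'.
Proof. by rewrite /dotp tr_col_mx mul_row_col mxE. Qed.

Lemma norm2E k (v : 'cV[R]_k) : norm2 v = form_norm (@dotp R k) v.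
Proof.
rewrite /norm2 /form_norm dotpE; congr Num.sqrt.
by apply: eq_bigr => i _; rewrite big_ord1 expr2.
Qed.

Lemma norm2_sqr k (v : 'cV[R]_k) : norm2 v ^+ 2 = dotp v v.
Proof. by rewrite norm2E (form_normK (@dotp_ge0 k)). Qed.

Lemma norm2_ge0 m n (M : 'M[R]_(m, n)) : 0 <= norm2 M.
Proof. exact: sqrtr_ge0. Qed.

Lemma dotp_le_norm2 k (u v : 'cV[R]_k) : dotp u v <= norm2 u * norm2 v.
Proof.
rewrite !norm2E; apply: form_CauchySchwarz;
  [exact: dotpDl|exact: dotpZl|exact: dotpC|exact: dotp_ge0].
Qed.

Lemma norm2D k (u v : 'cV[R]_k) : norm2 (u + v) <= norm2 u + norm2 v.
Proof.
rewrite !norm2E; apply: form_normD;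
  [exact: dotpDl|exact: dotpZl|exact: dotpC|exact: dotp_ge0].
Qed.

Lemma norm2Z k t (u : 'cV[R]_k) : norm2 (t *: u) = `|t| * norm2 u.
Proof. by rewrite !norm2E form_normZ; [| exact: dotpZl | exact: dotpC]. Qed.

Lemma norm2N k (u : 'cV[R]_k) : norm2 (- u) = norm2 u.
Proof. by rewrite -scaleN1r norm2Z normrN1 mul1r. Qed.

Lemma norm20 k : norm2 (0 : 'cV[R]_k) = 0.
Proof. by rewrite -(scale0r 0) norm2Z normr0 mul0r. Qed.

Lemma norm2_sum k I (r : seq I) (F : I -> 'cV[R]_k) :
  norm2 (\sum_(i <- r) F i) <= \sum_(i <- r) norm2 (F i).
Proof.
elim: r => [|i r IHr]; first by rewrite !big_nil norm20.
by rewrite !big_cons; apply: le_trans (norm2D _ _) _; rewrite lerD2l.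
Qed.

Lemma norm2_coord k (u : 'cV[R]_k) i : `|u i 0| <= norm2 u.
Proof.
rewrite -(ler_pXn2r (n := 2)) ?nnegrE ?norm2_ge0 //.
rewrite real_normK ?num_real // norm2_sqr dotpE (bigD1 i) //= -expr2 lerDl.
by rewrite sumr_ge0 // => j _; rewrite -expr2 sqr_ge0.
Qed.

Lemma norm2_eq0 k (u : 'cV[R]_k) : norm2 u = 0 -> u = 0.
Proof.
move=> u0; apply/matrixP => i j; rewrite ord1 mxE; apply/eqP.
by rewrite -normr_le0 -u0 norm2_coord.
Qed.

Lemma norm2_gt0 k (u : 'cV[R]_k) : u != 0 -> 0 < norm2 u.
Proof.
by move=> u0; rewrite lt_def norm2_ge0 andbT; apply: contra_neq u0 => /norm2_eq0.
Qed.

Lemma norm1_ge0 k (u : 'cV[R]_k) : 0 <= norm1 u.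
Proof. exact: sumr_ge0. Qed.

Lemma norm2_le_norm1 k (u : 'cV[R]_k) : norm2 u <= norm1 u.
Proof.
have {1}-> : u = \sum_i u i 0 *: delta_mx i 0.
  by rewrite {1}(matrix_sum_delta u); apply: eq_bigr => i _; rewrite big_ord1.
apply: le_trans (norm2_sum _ _) _; apply: ler_sum => i _.
rewrite norm2Z ler_piMr // -(ler_pXn2r (n := 2)) ?nnegrE ?norm2_ge0 ?ler01 //.
rewrite norm2_sqr dotpE (bigD1 i) //= big1 ?mxE ?eqxx ?mulr1 ?addr0 ?expr1n //.
by move=> j ji; rewrite mxE (negPf ji) mul0r.
Qed.

Lemma norm2_col_mx k1 k2 (u : 'cV[R]_k1) (v : 'cV[R]_k2) :
  norm2 (col_mx u v) ^+ 2 = norm2 u ^+ 2 + norm2 v ^+ 2.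
Proof. by rewrite !norm2_sqr dotp_col_mx. Qed.

Lemma norm2_col_mx_le k1 k2 (u : 'cV[R]_k1) (v : 'cV[R]_k2) :
  norm2 (col_mx u v) <= norm2 u + norm2 v.
Proof.
rewrite -(ler_pXn2r (n := 2)) ?nnegrE ?addr_ge0 ?norm2_ge0 //.
by rewrite norm2_col_mx sqrrD -addrA lerD2l lerDr mulrn_wge0 ?mulr_ge0 ?norm2_ge0.
Qed.

Lemma norm2_mulmx_col m n (M : 'M[R]_(m, n)) (v : 'cV_n) :
  norm2 (M *m v) <= \sum_j `|v j 0| * norm2 (col j M).
Proof.
have -> : M *m v = \sum_j v j 0 *: col j M :> 'cV_m.
  apply/matrixP => i k; rewrite ord1 mxE summxE; apply: eq_bigr => j _.
  by rewrite !mxE mulrC.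
apply: le_trans (norm2_sum _ _) _.
by apply: ler_sum => j _; rewrite norm2Z.
Qed.

Lemma norm2_mulmx_bound m n (M : 'M[R]_(m, n)) (v : 'cV_n) :
  norm2 (M *m v) <= norm2 v * \sum_j norm2 (col j M).
Proof.
apply: le_trans (norm2_mulmx_col _ _) _; rewrite mulr_sumr.
by apply: ler_sum => j _; rewrite ler_wpM2r ?norm2_ge0 ?norm2_coord.
Qed.

Local Open Scope classical_set_scope.

Lemma spectral_norm_has_sup m n (M : 'M[R]_(m, n)) :
  has_sup [set norm2 (M *m v) | v in [set v : 'cV[R]_n | norm2 v <= 1]].
Proof.
split; first by exists (norm2 (M *m (0 : 'cV_n))), 0 => //=; rewrite norm20 ler01.
exists (\sum_j norm2 (col j M)) => _ [v /= v1 <-].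
apply: le_trans (norm2_mulmx_bound _ _) _.
by rewrite ler_piMl // sumr_ge0 // => j _; exact: norm2_ge0.
Qed.

Lemma norm2_mulmx_spectral m n (M : 'M[R]_(m, n)) (v : 'cV_n) :
  norm2 (M *m v) <= spectral_norm M * norm2 v.
Proof.
have [->|v0] := eqVneq v 0; first by rewrite mulmx0 !norm20 mulr0.
have vgt0 := norm2_gt0 v0.
rewrite -ler_pdivrMr // mulrC -[_^-1]ger0_norm ?invr_ge0 ?norm2_ge0 // -norm2Z.
rewrite scalemxAr; apply: (ub_le_sup (spectral_norm_has_sup M).2).
exists ((norm2 v)^-1 *: v) => //=.
by rewrite norm2Z ger0_norm ?invr_ge0 ?norm2_ge0 // mulVf // gt_eqF.
Qed.

Lemma spectral_norm_le m n (M : 'M[R]_(m, n)) t : 0 <= t ->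
  (forall v : 'cV_n, norm2 (M *m v) <= t * norm2 v) -> spectral_norm M <= t.
Proof.
move=> t0 Mt; apply: ge_sup; first exact: (spectral_norm_has_sup M).1.
by move=> _ [v /= v1 <-]; apply: le_trans (Mt v) _; rewrite ler_piMr.
Qed.

Lemma spectral_norm_ge0 m n (M : 'M[R]_(m, n)) : 0 <= spectral_norm M.
Proof.
apply: (ub_le_sup (spectral_norm_has_sup M).2).
by exists 0; rewrite /= ?mulmx0 norm20.
Qed.

(** [|M^T u|^2 = <M M^T u, u>] is at most [t |M^T u| |u|]; cancel [|M^T u|]. *)
Lemma norm2_trmx_bound m n (M : 'M[R]_(m, n)) t : 0 <= t ->
  (forall v : 'cV_n, norm2 (M *m v) <= t * norm2 v) ->
  forall u : 'cV_m, norm2 (M^T *m u) <= t * norm2 u.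
Proof.
move=> t0 Mt u; have [->|u0] := eqVneq (M^T *m u) 0.
  by rewrite norm20 mulr_ge0 ?norm2_ge0.
have gt0 := norm2_gt0 u0.
rewrite -(ler_pM2l gt0) -expr2 norm2_sqr -dotp_mull mulrA.
apply: le_trans (dotp_le_norm2 _ _) _; rewrite ler_wpM2r ?norm2_ge0 //.
by rewrite mulrC Mt.
Qed.

End Euclid.

(** * Extreme singular values *)

Section SingularValues.
Context {R : realType}.

(* The eigenvalue is the largest [t] for which [H = G - t I] is semidefinite: if
   [H] were invertible, Cauchy-Schwarz for [H] at [v] and [H^-1 v] would bound
   [v^T H v] below by a positive multiple of [|v|^2]. *)
Lemma symmetric_min_eigen (m : nat) (G : 'M[R]_m) : (0 < m)%N -> G^T = G ->
  exists mu (v : 'cV[R]_m), [/\ v != 0, G *m v = mu *: v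
    & forall u, mu * dotp u u <= dotp u (G *m u)].
Proof.
case: m G => // m G _ GT.
pose c := \sum_j norm2 (col j G).
pose S := [set t : R | forall u : 'cV_m.+1, t * dotp u u <= dotp u (G *m u)]%classic.
have S0 : S !=set0%classic.
  exists (- c) => u; rewrite mulNr lerNl -dotpNl.
  have /le_trans := dotp_le_norm2 (- u) (G *m u); apply; rewrite norm2N -norm2_sqr.
  rewrite expr2 mulrA [c * _]mulrC [leRHS]mulrC.
  by rewrite ler_wpM2l ?norm2_ge0 ?norm2_mulmx_bound.
have ubS (u : 'cV_m.+1) : u != 0 -> ubound S (dotp u (G *m u) / dotp u u).
  move=> u0 t St; rewrite ler_pdivlMr //.
  by rewrite -norm2_sqr exprn_gt0 // norm2_gt0.
pose u1 : 'cV[R]_m.+1 := const_mx 1.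
have u1n0 : u1 != 0.
  apply/eqP => /matrixP /(_ 0 0); rewrite !mxE; apply/eqP; exact: oner_neq0.
have supS : has_sup S by split=> //; exists (dotp u1 (G *m u1) / dotp u1 u1); exact: ubS.
have Smu : S (sup S).
  move=> u; have [->|u0] := eqVneq u 0; first by rewrite !dotp0l mulr0.
  rewrite -ler_pdivlMr ?(ge_sup _ (ubS _ u0)) //.
  by rewrite -norm2_sqr exprn_gt0 // norm2_gt0.
pose H := G - (sup S)%:M.
have HT : H^T = H by rewrite /H linearB /= GT tr_scalar_mx.
have HE u v : dotp u (H *m v) = dotp u (G *m v) - sup S * dotp u v.
  by rewrite /H mulmxBl dotpDr mul_scalar_mx dotpNr dotpZr.
have [Hunit|] := boolP (H \in unitmx); last first.
  rewrite unitmxE unitfE negbK => /det0P [v v0 vH].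
  exists (sup S), v^T; split=> //; first by rewrite trmx_eq0.
  apply/eqP; rewrite -subr_eq0 -mul_scalar_mx -mulmxBl -/H.
  by rewrite -[H]HT -trmx_mul vH trmx0.
(* [k] bounds the norm of [invmx H], so Cauchy-Schwarz gives [|v|^2 / k <= v^T H v], which would put
   [sup S + 1 / k] into [S]. *)
pose k := 1 + \sum_j norm2 (col j (invmx H)).
have k_gt0 : 0 < k.
  by rewrite ltr_pwDl ?sumr_ge0 ?ltr01 // => j _; exact: norm2_ge0.
have /(ub_le_sup supS.2) : S (sup S + k^-1).
  move=> v; rewrite mulrDl -lerBrDl -HE.
  have [->|v0] := eqVneq v 0; first by rewrite !dotp0l mulr0.
  have v2 : 0 < dotp v v by rewrite -norm2_sqr exprn_gt0 // norm2_gt0.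
  rewrite mulrC ler_pdivrMr // -(ler_pM2l v2) -expr2.
  pose f u w := dotp u (H *m w).
  have fC u w : f u w = f w u by rewrite /f -{1}HT -dotp_mull dotpC.
  have f0 u : 0 <= f u u by rewrite /f HE subr_ge0 Smu.
  have fDl u v' w : f (u + v') w = f u w + f v' w by rewrite /f dotpDl.
  have fZl t u w : f (t *: u) w = t * f u w by rewrite /f dotpZl.
  have := form_CauchySchwarz_sqr fDl fZl fC f0 v (invmx H *m v).
  rewrite /f mulmxA mulmxV // mul1mx => /le_trans; apply.
  rewrite [leRHS]mulrCA ler_wpM2l //; first exact: f0.
  apply: le_trans (dotp_le_norm2 _ _) _; rewrite -norm2_sqr expr2 mulrAC.
  rewrite ler_wpM2r ?norm2_ge0 //; apply: le_trans (norm2_mulmx_bound _ _) _.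
  by rewrite ler_wpM2l ?norm2_ge0 // lerDr ler01.
by rewrite gerDl leNgt invr_gt0 k_gt0.
Qed.

Section Bounds.
Variables (m n : nat) (A : 'M[R]_(m, n)).
Hypotheses (m_gt0 : (0 < m)%N) (freeA : row_free A).

Lemma row_free_trmx_neq0 (y : 'cV[R]_m) : y != 0 -> A^T *m y != 0.
Proof.
apply: contra_neq => /(congr1 trmx); rewrite trmx_mul trmxK trmx0 => yA.
apply/eqP; rewrite -trmx_eq0; apply/eqP.
by apply: (row_free_inj freeA); rewrite yA mul0mx.
Qed.

Lemma singular_valueP s : nonzero_singular_value A s -> exists w : 'cV[R]_n,
  [/\ w != 0, 0 < s, norm2 (A *m w) = s * norm2 w
    & norm2 (A^T *m (A *m w)) = s ^+ 2 * norm2 w].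
Proof.
move=> [s_gt0 /eigenvalueP [v vE v0]].
have wE : A^T *m (A *m v^T) = s ^+ 2 *: v^T.
  by rewrite -linearZ -vE /= !trmx_mul trmxK mulmxA.
exists v^T; split; rewrite ?trmx_eq0 //; last first.
  by rewrite wE norm2Z ger0_norm // sqr_ge0.
apply/eqP; rewrite -(eqrXn2 (n := 2)) ?mulr_ge0 ?norm2_ge0 ?ltW //.
by rewrite exprMn !norm2_sqr dotp_mull wE dotpZr.
Qed.

(** If [y] is an eigenvector of [A A^T], then [A^T y] is one of [A^T A] for the same eigenvalue; row
    freeness makes it nonzero and the eigenvalue positive. *)
Lemma singular_valueI mu (y : 'cV[R]_m) : y != 0 -> 0 <= mu ->
  A *m (A^T *m y) = mu *: y -> nonzero_singular_value A (Num.sqrt mu).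
Proof.
move=> y0 mu0 yE; have Ay0 := row_free_trmx_neq0 y0.
have mu_gt0 : 0 < mu.
  rewrite lt_def mu0 andbT; apply: contra_neq Ay0 => mu00.
  apply: norm2_eq0; apply/eqP; rewrite -sqrf_eq0 norm2_sqr dotp_mull trmxK.
  by rewrite yE mu00 scale0r dotp0r.
split; rewrite ?sqrtr_gt0 // sqr_sqrtr //; apply/eigenvalueP.
exists (A^T *m y)^T; last by rewrite trmx_eq0.
by rewrite mulmxA -trmx_mul yE linearZ /= -scalemxAl trmx_mul trmxK.
Qed.

(** The extreme eigenvalues of [A A^T] are attained and, by row freeness, positive, so their square
    roots are singular values. Conversely, for an eigenvector [w] of [A^T A] at [s ^ 2], the bounds
    on [A^T] tested at [A w] confine [s] between them. *)
Lemma singular_bounds :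
  [/\ 0 < lambda_min A, lambda_min A <= lambda_max A,
      forall x : 'cV[R]_n, norm2 (A *m x) <= lambda_max A * norm2 x,
      forall y : 'cV[R]_m, lambda_min A * norm2 y <= norm2 (A^T *m y)
    & lambda_max A <= spectral_norm A].
Proof.
have GT : (A *m A^T)^T = A *m A^T by rewrite trmx_mul trmxK.
have [mu [y [y0 yE muP]]] := symmetric_min_eigen m_gt0 GT.
have [nu [z [z0 zE nuP]]] :
  exists nu (v : 'cV[R]_m), [/\ v != 0, A *m A^T *m v = nu *: v
    & forall u, dotp u (A *m A^T *m u) <= nu * dotp u u].
  (* The largest eigenvalue is minus the smallest one of [- (A A^T)]. *)
  have [|nu [z [z0 zE nuP]]] := symmetric_min_eigen (G := - (A *m A^T)) m_gt0.
    by rewrite linearN /= GT.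
  exists (- nu), z; split=> //; first by rewrite scaleNr -zE mulNmx opprK.
  by move=> u; rewrite mulNr lerNr -dotpNr -mulNmx.
have GE (u : 'cV_m) : dotp u (A *m A^T *m u) = norm2 (A^T *m u) ^+ 2.
  by rewrite -mulmxA dotpC dotp_mull -norm2_sqr.
have eigen_ge0 t (v : 'cV[R]_m) : v != 0 -> A *m A^T *m v = t *: v -> 0 <= t.
  move=> v0 vE; have v2 : 0 < norm2 v ^+ 2 by rewrite exprn_gt0 // norm2_gt0.
  by rewrite -(pmulr_lge0 _ v2) norm2_sqr -dotpZr -vE GE sqr_ge0.
have mu_ge0 := eigen_ge0 _ _ y0 yE; have nu_ge0 := eigen_ge0 _ _ z0 zE.
have smu : nonzero_singular_value A (Num.sqrt mu).
  by apply: (singular_valueI y0); rewrite ?mulmxA.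
have snu : nonzero_singular_value A (Num.sqrt nu).
  by apply: (singular_valueI z0); rewrite ?mulmxA.
have AT_ge (u : 'cV_m) : Num.sqrt mu * norm2 u <= norm2 (A^T *m u).
  rewrite -(ler_pXn2r (n := 2)) ?nnegrE ?mulr_ge0 ?norm2_ge0 ?sqrtr_ge0 //.
  by rewrite exprMn sqr_sqrtr // norm2_sqr -GE muP.
have AT_le (u : 'cV_m) : norm2 (A^T *m u) <= Num.sqrt nu * norm2 u.
  rewrite -(ler_pXn2r (n := 2)) ?nnegrE ?mulr_ge0 ?norm2_ge0 ?sqrtr_ge0 //.
  by rewrite exprMn [Num.sqrt nu ^+ 2]sqr_sqrtr // -GE norm2_sqr nuP.
have s_ge : lbound (nonzero_singular_value A) (Num.sqrt mu).
  move=> s /singular_valueP [w [w0 s_gt0 Aw ATAw]].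
  have := AT_ge (A *m w); rewrite ATAw Aw expr2 -mulrA mulrCA.
  by rewrite ler_pM2l // ler_pM2r // norm2_gt0.
have s_le : ubound (nonzero_singular_value A) (Num.sqrt nu).
  move=> s /singular_valueP [w [w0 s_gt0 Aw ATAw]].
  have := AT_le (A *m w); rewrite ATAw Aw expr2 -mulrA [leRHS]mulrCA.
  by rewrite ler_pM2l // ler_pM2r // norm2_gt0.
have minE : lambda_min A = Num.sqrt mu.
  apply/eqP; rewrite eq_le lb_le_inf ?andbT; last exact: s_ge.
    by apply: ge_inf => //; exists (Num.sqrt mu).
  by exists (Num.sqrt mu).
have maxE : lambda_max A = Num.sqrt nu.
  apply/eqP; rewrite eq_le ge_sup /=; last exact: s_le.
    by apply: ub_le_sup => //; exists (Num.sqrt nu).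
  by exists (Num.sqrt nu).
rewrite minE maxE; split=> //; first by case: smu.
- exact: s_le.
- move=> x; rewrite -[A in norm2 (A *m _)]trmxK.
  by apply: norm2_trmx_bound; rewrite ?sqrtr_ge0.
- have [w [w0 s_gt0 Aw _]] := singular_valueP snu.
  have := norm2_mulmx_spectral A w; rewrite Aw ler_pM2r //.
  exact: norm2_gt0.
Qed.

End Bounds.
End SingularValues.

(** * Linear programs with unique optima *)

Section UniqueOptimum.
Context {R : realType}.

Section Direction.
Variables (m n : nat) (A : 'M[R]_(m, n)) (b : 'cV[R]_m) (c xs : 'cV[R]_n).
Hypothesis xs_uniq : unique_primal_optimal A b c xs.

(** A short step along [d] stays feasible, so [d] cannot decrease the cost; a zero change would
    produce a second optimal solution. *)
Lemma unique_primal_direction (d : 'cV[R]_n) : d != 0 -> A *m d = 0 ->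
  (forall i, xs i 0 = 0 -> 0 <= d i 0) -> 0 < dotp c d.
Proof.
move=> d0 Ad d_ge0; have [[[Axs xs0] xs_min] xs_unique] := xs_uniq.
(* Indices with [xs i 0 = 0] contribute [x / 0 = 0] to this sum. *)
pose t := (1 + \sum_i `|d i 0| / xs i 0)^-1.
have t_gt0 : 0 < t.
  by rewrite invr_gt0 ltr_pwDl ?ltr01 ?sumr_ge0 // => i _; rewrite divr_ge0.
have feas : primal_feasible A b (xs + t *: d).
  split=> [|i]; first by rewrite mulmxDr -scalemxAr Ad scaler0 addr0.
  rewrite !mxE; have := xs0 i; rewrite le_eqVlt => /predU1P [xi0|xi_gt0].
    by rewrite -xi0 add0r mulr_ge0 ?(ltW t_gt0) ?d_ge0.
  rewrite -lerBlDl sub0r lerNl; apply: le_trans (ler_norm _) _.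
  rewrite normrN normrM (gtr0_norm t_gt0) mulrC -ler_pdivlMr // invrK.
  rewrite -ler_pdivrMl // mulrC (bigD1 i) //= addrCA lerDl.
  by rewrite addr_ge0 ?ler01 ?sumr_ge0 // => j _; rewrite divr_ge0.
have := xs_min _ feas; rewrite dotpDr dotpZr lerDl pmulr_rge0 // le_eqVlt.
case/predU1P => // cd0; case/eqP: d0.
have /xs_unique : primal_optimal A b c (xs + t *: d).
  by split=> // x' /xs_min; rewrite dotpDr dotpZr -cd0 mulr0 addr0.
move/(congr1 (fun x => x - xs)); rewrite addrAC subrr add0r => /eqP.
by rewrite scaler_eq0 gt_eqF //= => /eqP.
Qed.

End Direction.

Section Structure.
Variables (m p : nat) (A : 'M[R]_(m, m + p)) (b : 'cV[R]_m).
Variables (c xs ss : 'cV[R]_(m + p)) (ys : 'cV[R]_m).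
Hypothesis xs_uniq : unique_primal_optimal A b c xs.
Hypothesis ys_uniq : unique_dual_optimal A b c (ys, ss).
Hypothesis xs_supp : pos_support xs = [set i : 'I_(m + p) | (i < m)%N]%SET.

Let B := basis_mx A.
Let N := nonbasis_mx A.

Lemma xs_lshift i : 0 < xs (lshift p i) 0.
Proof.
have : lshift p i \in pos_support xs by rewrite xs_supp inE /= ltn_ord.
by rewrite inE.
Qed.

Lemma xs_rshift j : xs (rshift m j) 0 = 0.
Proof.
have : rshift m j \notin pos_support xs.
  by rewrite xs_supp inE /= -leqNgt leq_addr.
have [[[_ xs0] _] _] := xs_uniq.
by rewrite inE -leNgt => xj; apply/eqP; rewrite eq_le xj xs0.
Qed.

Lemma mulmx_basis (u : 'cV[R]_m) (v : 'cV[R]_p) :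
  A *m col_mx u v = B *m u + N *m v.
Proof. by rewrite -[A in LHS]hsubmxK mul_row_col. Qed.

Lemma trmx_basis (y : 'cV[R]_m) : A^T *m y = col_mx (B^T *m y) (N^T *m y).
Proof. by rewrite -[A in LHS]hsubmxK tr_row_mx mul_col_mx. Qed.

(** A kernel vector of [B], padded with zeros, could be followed both ways from [xs], and its cost
    would have to be positive both ways. *)
Lemma basis_mx_unit : B \in unitmx.
Proof.
rewrite -unitmx_tr unitmxE unitfE; apply/det0P => -[v v0 vB].
have Bv : B *m v^T = 0 by rewrite -[B]trmxK -trmx_mul vB trmx0.
have dir (e : R) : e != 0 -> 0 < dotp c (e *: col_mx v^T 0).
  move=> e0; apply: (unique_primal_direction xs_uniq).
  - rewrite scaler_eq0 (negPf e0) /=; apply: contra_neq v0 => /eqP.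
    by rewrite col_mx_eq0 trmx_eq0 => /andP [/eqP].
  - by rewrite -scalemxAr mulmx_basis Bv mulmx0 addr0 scaler0.
  - move=> i; case: (split_ordP i) => j ->.
      by move=> xj; have := xs_lshift j; rewrite xj ltxx.
    by rewrite mxE col_mxEd mxE mulr0.
have := dir 1 (oner_neq0 _); have := dir (-1); rewrite oppr_eq0 oner_neq0.
rewrite !dotpZr => /(_ isT); lra.
Qed.

Let D := invmx B *m N.

(** Uniqueness of the primal optimum yields strict complementarity. The candidate [y0 = B^-T c_B]
    has zero slack on the basis, and its other slacks are costs of feasible directions at [xs],
    hence positive. Complementary slackness makes it dual optimal, so it is the given dual
    solution. *)
Lemma dual_optimal_basis : exists y s, [/\ y = ys, s = ss, A^T *m y + s = c,
  forall i, s (lshift p i) 0 = 0 & forall j, 0 < s (rshift m j) 0].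
Proof.
have Bu := basis_mx_unit.
have BTu : B^T \in unitmx by rewrite unitmx_tr.
pose y0 := invmx B^T *m usubmx c; pose s0 := c - A^T *m y0.
have eq0 : A^T *m y0 + s0 = c by rewrite /s0 addrC subrK.
have s0B i : s0 (lshift p i) 0 = 0.
  rewrite /s0 trmx_basis /y0 mulmxA mulmxV // mul1mx -{1}[c]vsubmxK.
  by rewrite mxE [X in _ + X]mxE !col_mxEu subrr.
have s0N j : 0 < s0 (rshift m j) 0.
  (* [d] raises the nonbasic variable [j] at unit rate and lets the basic ones compensate; its cost
     is the slack of [j]. *)
  pose d : 'cV[R]_(m + p) := col_mx (- col j D) (delta_mx j 0).
  have Ad : A *m d = 0.
    rewrite mulmx_basis mulmxN colE /D !mulmxA mulmxV // mul1mx.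
    by rewrite addrC subrr.
  have -> : s0 (rshift m j) 0 = dotp c d.
    rewrite -eq0 dotpDl -[A^T in RHS]/(A^T) dotp_mull trmxK Ad dotp0r add0r.
    rewrite dotpE big_split_ord /= big1 ?add0r => [|i _]; last by rewrite s0B mul0r.
    rewrite (bigD1 j) //= big1 => [|i ij]; rewrite col_mxEd [delta_mx _ _ _ _]mxE.
      by rewrite !eqxx mulr1 addr0.
    by rewrite (negPf ij) mulr0.
  apply: (unique_primal_direction xs_uniq) => //.
    apply/eqP => /matrixP /(_ (rshift m j) 0); rewrite col_mxEd !mxE !eqxx.
    by apply/eqP; exact: oner_neq0.
  move=> i; case: (split_ordP i) => k ->.
    by move=> xk; have := xs_lshift k; rewrite xk ltxx.
  by rewrite col_mxEd mxE ler0n.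
exists y0, s0; have [[[Axs xs0] _] _] := xs_uniq.
suff : (y0, s0) = (ys, ss) by case=> <- <-; split.
have [_ dual_unique] := ys_uniq; apply: dual_unique.
have feas : dual_feasible A c (y0, s0).
  split=> //= i; case: (split_ordP i) => k ->.
    by rewrite s0B.
  exact: ltW.
(* The dual value falls short of the primal one by [s^T xs], which is zero for [s0] and nonnegative
   for every feasible [s]. *)
have valE y s : A^T *m y + s = c -> dotp b y = dotp c xs - dotp s xs.
  move=> ysE; rewrite -ysE -Axs dotpDl addrK dotp_mull.
  exact: dotpC.
split=> // -[y s] [/= ysE s_ge0]; rewrite (valE _ _ ysE) (valE _ _ eq0) lerD2l lerN2.
rewrite [leLHS](_ : _ = 0) ?dotpE ?sumr_ge0 // => [i _|]; first by rewrite mulr_ge0.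
rewrite big_split_ord /= big1 => [|i _]; last by rewrite s0B mul0r.
by rewrite add0r big1 // => j _; rewrite xs_rshift mulr0.
Qed.

Lemma lp_structure : [/\ B \in unitmx, A *m xs = b, A^T *m ys + ss = c,
  forall i, 0 < xs (lshift p i) 0 /\ ss (lshift p i) 0 = 0
  & forall j, xs (rshift m j) 0 = 0 /\ 0 < ss (rshift m j) 0].
Proof.
have [y [s [-> -> eq sB sN]]] := dual_optimal_basis.
have [[[Axs _] _] _] := xs_uniq.
split=> // [|i|j]; first exact: basis_mx_unit.
- by rewrite xs_lshift.
- by rewrite xs_rshift.
Qed.

End Structure.
End UniqueOptimum.

(** * One inner loop of PDHG *)

Section PDHG.
Context {R : realType} {m n : nat}.
Variables (A : 'M[R]_(m, n)) (b : 'cV[R]_m) (c : 'cV[R]_n) (a l : R).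
Hypotheses (l_gt0 : 0 < l) (le_la : l <= a)
  (A_le : forall x : 'cV[R]_n, norm2 (A *m x) <= a * norm2 x).

Local Notation pd := ('cV[R]_n * 'cV[R]_m)%type.
Local Notation kap := (a / l).
Local Notation tau := ((2 * kap)^-1).
Local Notation sigma := ((2 * a * l)^-1).
Local Notation step := (onePDHG A b c tau sigma).
Local Notation avg := (average A b c tau sigma).

Let a_gt0 : 0 < a. Proof. exact: lt_le_trans le_la. Qed.
Let kap_gt0 : 0 < kap. Proof. exact: divr_gt0. Qed.

(* The matrix [Mmx] is the form with [e = -1]; PDHG is a proximal point
   iteration for the one with [e = 1]. *)
Definition pform (e : R) (z z' : pd) : R :=
  2 * kap * dotp z.1 z'.1 + e * (dotp (A *m z.1) z'.2 + dotp (A *m z'.1) z.2)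
  + 2 * a * l * dotp z.2 z'.2.

Definition pnorm (e : R) : pd -> R := form_norm (pform e).

Lemma pformDl e z z' w : pform e (z + z') w = pform e z w + pform e z' w.
Proof. by rewrite /pform /= !mulmxDr !dotpB; ring. Qed.

Lemma pformZl e t z w : pform e (t *: z) w = t * pform e z w.
Proof. by rewrite /pform /= -!scalemxAr !(dotpZl, dotpZr); ring. Qed.

Lemma pformC e z w : pform e z w = pform e w z.
Proof.
by rewrite /pform (dotpC z.1) (dotpC z.2) [dotp (A *m z.1) _ + _]addrC.
Qed.

Lemma dotp_mulmx_abs x y : `|dotp (A *m x) y| <= a * norm2 x * norm2 y.
Proof.
rewrite ler_norml lerNl -dotpNr.
suff H y' : dotp (A *m x) y' <= a * norm2 x * norm2 y'.
  by rewrite H -(norm2N y) H.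
by apply: le_trans (dotp_le_norm2 _ _) _; rewrite ler_wpM2r ?norm2_ge0.
Qed.

(** Since [a = kap * l], the diagonal part is [2 kap (|x|^2 + (l |y|)^2)], and by the AM-GM
    inequality the cross term is at most half of it, whatever its sign. *)
Lemma pform_bounds e z : e ^+ 2 = 1 ->
  kap * (norm2 z.1 ^+ 2 + (l * norm2 z.2) ^+ 2) <= pform e z z <=
  3 * kap * (norm2 z.1 ^+ 2 + (l * norm2 z.2) ^+ 2).
Proof.
move=> e1; rewrite /pform -!norm2_sqr.
have := dotp_mulmx_abs z.1 z.2; set d := dotp _ _.
set u := norm2 z.1; set v := norm2 z.2.
have : a * u * v * 2 <= kap * (u ^+ 2 + (l * v) ^+ 2).
  have -> : a * u * v * 2 = kap * (2 * u * (l * v)).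
    by field; rewrite gt_eqF.
  rewrite ler_wpM2l ?(ltW kap_gt0) // -subr_ge0.
  by rewrite (_ : _ - _ = (u - l * v) ^+ 2) ?sqr_ge0 //; ring.
have -> : 2 * a * l * v ^+ 2 = 2 * kap * (l * v) ^+ 2.
  by field; rewrite gt_eqF.
have : `|e * d| = `|d|.
  have /eqP := e1; rewrite sqrf_eq1 => /orP [] /eqP ->; rewrite ?mul1r //.
  by rewrite mulN1r normrN.
move=> <-; rewrite mulrDr ler_norml; lra.
Qed.

Lemma sqr_sgn1 : (1 : R) ^+ 2 = 1. Proof. exact: expr1n. Qed.

Lemma sqr_sgnN1 : (-1 : R) ^+ 2 = 1. Proof. by rewrite sqrrN expr1n. Qed.

Section Sign.
Variable e : R.
Hypothesis e1 : e ^+ 2 = 1.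

Lemma pform_ge0 z : 0 <= pform e z z.
Proof.
have /andP [+ _] := pform_bounds z e1; apply: le_trans.
by rewrite mulr_ge0 ?addr_ge0 ?sqr_ge0 ?(ltW kap_gt0).
Qed.

Lemma pnorm_sqr z : pnorm e z ^+ 2 = pform e z z.
Proof. exact/form_normK/pform_ge0. Qed.

Lemma pnorm_ge0 z : 0 <= pnorm e z. Proof. exact: form_norm_ge0. Qed.

Lemma pnormD z w : pnorm e (z + w) <= pnorm e z + pnorm e w.
Proof.
by apply: form_normD; [exact: pformDl|exact: pformZl|exact: pformC|exact: pform_ge0].
Qed.

Lemma pnormZ t z : pnorm e (t *: z) = `|t| * pnorm e z.
Proof. by apply: form_normZ; [exact: pformZl|exact: pformC]. Qed.

Lemma pnorm_distC z w : pnorm e (z - w) = pnorm e (w - z).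
Proof. by apply: form_norm_distC; [exact: pformZl|exact: pformC]. Qed.

Lemma pnorm_dist z w v : pnorm e (z - v) <= pnorm e (z - w) + pnorm e (w - v).
Proof. by rewrite -[z - v](subrKA w) pnormD. Qed.

Lemma pnorm_ge_primal z : Num.sqrt kap * norm2 z.1 <= pnorm e z.
Proof.
rewrite -(ler_pXn2r (n := 2)) ?nnegrE ?mulr_ge0 ?norm2_ge0 ?sqrtr_ge0 ?pnorm_ge0 //.
rewrite exprMn [Num.sqrt kap ^+ 2]sqr_sqrtr ?(ltW kap_gt0) // pnorm_sqr.
have /andP [+ _] := pform_bounds z e1; apply: le_trans.
by rewrite ler_wpM2l ?(ltW kap_gt0) // lerDl sqr_ge0.
Qed.

Lemma pnorm_ge_dual z : Num.sqrt kap * (l * norm2 z.2) <= pnorm e z.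
Proof.
have l_ge0 := ltW l_gt0.
rewrite -(ler_pXn2r (n := 2)) ?nnegrE ?mulr_ge0 ?norm2_ge0 ?sqrtr_ge0 ?pnorm_ge0 //.
rewrite exprMn [Num.sqrt kap ^+ 2]sqr_sqrtr ?(ltW kap_gt0) // pnorm_sqr.
have /andP [+ _] := pform_bounds z e1; apply: le_trans.
by rewrite ler_wpM2l ?(ltW kap_gt0) // lerDr sqr_ge0.
Qed.

Lemma pnorm_le z : pnorm e z <= 2 * Num.sqrt kap * (norm2 z.1 + l * norm2 z.2).
Proof.
have l_ge0 := ltW l_gt0.
rewrite -(ler_pXn2r (n := 2)) ?nnegrE ?mulr_ge0 ?addr_ge0 ?mulr_ge0 ?norm2_ge0
  ?sqrtr_ge0 ?pnorm_ge0 //.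
rewrite !exprMn [Num.sqrt kap ^+ 2]sqr_sqrtr ?(ltW kap_gt0) // pnorm_sqr.
have /andP [_ +] := pform_bounds z e1; move/le_trans; apply.
move: (kap) (ltW kap_gt0) => t t0.
rewrite [3 * t]mulrC [2 ^+ 2 * t]mulrC -!mulrA ler_wpM2l //.
have := norm2_ge0 z.1; have := mulr_ge0 l_ge0 (norm2_ge0 z.2).
by set u := l * _; set v := norm2 _ => u0 v0; nra.
Qed.

Lemma pnorm_eq0 z : pnorm e z = 0 -> z = 0.
Proof.
have k_gt0 : 0 < Num.sqrt kap by rewrite sqrtr_gt0 divr_gt0.
move=> z0; have := pnorm_ge_primal z; have := pnorm_ge_dual z.
rewrite z0 !pmulr_rle0 // => y0 x0; case: z z0 x0 y0 => x y _ /= x0 y0.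
by congr pair; apply: norm2_eq0; apply/eqP; rewrite eq_le norm2_ge0 andbT.
Qed.

End Sign.

(** Both squared norms lie between [kap] and [3 kap] times the same quantity, and [3 <= 2 ^ 2]. *)
Lemma pnorm_equiv e e' z : e ^+ 2 = 1 -> e' ^+ 2 = 1 -> pnorm e z <= 2 * pnorm e' z.
Proof.
move=> e1 e1'; rewrite -(ler_pXn2r (n := 2)) ?nnegrE ?mulr_ge0 ?pnorm_ge0 //.
rewrite exprMn !pnorm_sqr //.
have /andP [_] := pform_bounds z e1; have /andP [] := pform_bounds z e1'.
have := pform_ge0 e1' z; lra.
Qed.

Lemma normME z : normM A tau sigma z = pnorm (-1) z.
Proof.
rewrite /normM /pnorm /form_norm /Mmx mul_block_col dotp_col_mx; congr Num.sqrt.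
rewrite /pform !invrK !mul_scalar_mx !mulNmx !dotpB !dotpZr.
by rewrite -dotp_mull (dotpC z.2); ring.
Qed.

Local Notation pn := (pnorm 1).
Local Notation nM := (normM A tau sigma).

Lemma normM_le z : nM z <= 2 * pn z.
Proof. by rewrite normME pnorm_equiv ?sqr_sgn1 ?sqr_sgnN1. Qed.

Lemma pnorm_le_normM z : pn z <= 2 * nM z.
Proof. by rewrite normME pnorm_equiv ?sqr_sgn1 ?sqr_sgnN1. Qed.

(** * The duality gap along the iteration *)

Definition gap (z zh : pd) : R :=
  lagrangian A b c z.1 zh.2 - lagrangian A b c zh.1 z.2.

Lemma gapE z zh : gap z zh =
  dotp (b - A *m z.1) (zh.2 - z.2) - dotp (c - A^T *m z.2) (zh.1 - z.1).
Proof.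
rewrite /gap /lagrangian !dotpB !(dotpC (A^T *m _)) -!dotp_mull; ring.
Qed.

(** For fixed [zh] the gap is affine in [z], so it commutes with averages. *)
Lemma gap_average (K : nat) (F : nat -> pd) zh : (0 < K)%N ->
  K%:R * gap (K%:R^-1 *: \sum_(1 <= i < K.+1) F i) zh =
  \sum_(1 <= i < K.+1) gap (F i) zh.
Proof.
move=> K_gt0; have K0 : K%:R != 0 :> R by rewrite pnatr_eq0 -lt0n.
pose lin (z : pd) :=
  dotp c z.1 - dotp (A *m z.1) zh.2 - dotp b z.2 + dotp (A *m zh.1) z.2.
pose const := dotp b zh.2 - dotp c zh.1.
have gapL z : gap z zh = lin z + const.
  by rewrite /gap /lagrangian /lin /const; ring.
have linD z w : lin (z + w) = lin z + lin w.
  by rewrite /lin /= mulmxDr !dotpB; ring.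
have linZ t z : lin (t *: z) = t * lin z.
  by rewrite /lin /= -scalemxAr !(dotpZl, dotpZr); ring.
have lin0 : lin 0 = 0 by rewrite -(scale0r 0) linZ mul0r.
rewrite gapL linZ (big_morph lin linD lin0) mulrDr mulrA divff // mul1r.
rewrite [RHS](eq_bigr (fun i => lin (F i) + const)); last by move=> i _; exact: gapL.
by rewrite [RHS]big_split sumr_const_nat subn1 mulr_natl.
Qed.

Lemma gap_segment z zh t : gap z (z + t *: (zh - z)) = t * gap z zh.
Proof. by rewrite !gapE /= !(addrC z.1, addrC z.2) !addrK !dotpZr; ring. Qed.

Lemma nonneg_segment (z zh : pd) t : nonneg z.1 -> nonneg zh.1 -> 0 <= t <= 1 ->
  nonneg (z + t *: (zh - z)).1.
Proof.
move=> z0 zh0 /andP [t0 t1] i; rewrite /= !mxE; have := z0 i; have := zh0 i.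
move: (z.1 i 0) (zh.1 i 0) => u v v0 u0.
have -> : u + t * (v - u) = (1 - t) * u + t * v by ring.
by rewrite addr_ge0 ?mulr_ge0 // subr_ge0.
Qed.

Lemma saddle_gap z zh : saddle_point A b c z -> nonneg zh.1 -> gap z zh <= 0.
Proof.
move=> [_ [zy zx]] zh0; rewrite /gap subr_le0.
exact: le_trans (zy _) (zx _ zh0).
Qed.

Lemma gap_saddle z : nonneg z.1 -> (forall zh, nonneg zh.1 -> gap z zh <= 0) ->
  saddle_point A b c z.
Proof.
move=> z0 zgap; split=> //; split=> [y | x x0].
  by have := zgap (z.1, y) z0; rewrite /gap /= subr_le0.
by have := zgap (x, z.2) x0; rewrite /gap /= subr_le0.
Qed.

Lemma step_nonneg z : nonneg (step z).1.
Proof. by move=> i; rewrite /= mxE le_max lexx orbT. Qed.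

(** The optimality conditions of the two updates bound the gap by the proximal form at [zh - step z]
    and [step z - z]. Expanding the square of [zh - z] turns this into a difference of squares, up
    to a nonnegative term. *)
Lemma step_gap z zh : nonneg zh.1 ->
  gap (step z) zh <= (pform 1 (zh - z) (zh - z) -
                      pform 1 (zh - step z) (zh - step z)) / 2.
Proof.
move=> zh0.
(* This is the variational inequality of the projection onto the nonnegative orthant. *)
have proj : 0 <= dotp (c - A^T *m z.2 + (2 * kap) *: ((step z).1 - z.1))
                      (zh.1 - (step z).1).
  have xpE i : (step z).1 i 0 =
      Num.max (z.1 i 0 - tau * (c - A^T *m z.2) i 0) 0.
    by rewrite /= mxE [X in Num.max X]mxE [X in _ + X]mxE [X in - X]mxE.
  move: (step z).1 (c - _) xpE => xp g xpE.
  rewrite dotpE sumr_ge0 // => i _; rewrite !mxE xpE.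
  move: (zh.1 i 0) (zh0 i) (g i 0) (z.1 i 0) => xh xh0 gi xi.
  have : 0 < 2 * kap by rewrite mulr_gt0.
  move: (2 * kap) => s s0; have sn0 := lt0r_neq0 s0.
  have [h|h] := leP (xi - s^-1 * gi) 0; last first.
    by rewrite addrAC subrr add0r mulrN mulrA mulfV // mul1r subrr mul0r.
  rewrite subr0 mulr_ge0 // sub0r mulrN subr_ge0.
  by move: h; rewrite subr_le0 ler_pdivlMl.
have dual : (2 * a * l) *: ((step z).2 - z.2) = b - A *m (2 *: (step z).1 - z.1).
  rewrite /= addrC addKr scalerA mulfV ?scale1r //.
  by rewrite !mulf_neq0 ?pnatr_eq0 // gt_eqF.
have P0 := pform_ge0 sqr_sgn1 (step z - z).
have -> : zh - z = (zh - step z) + (step z - z) by rewrite subrKA.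
rewrite (form_sqrD (pformDl 1) (pformZl 1) (pformC 1)).
suff : gap (step z) zh <= pform 1 (zh - step z) (step z - z) by move=> H; lra.
rewrite -subr_ge0; apply: le_trans proj _.
move: dual => /(congr1 (fun u => dotp u (zh.2 - (step z).2))).
rewrite /pform /gap /lagrangian.
move: (step z) => {zh0 P0}; case: z zh => x y [xh yh] [x' y'] /=.
rewrite !(mulmxDr, mulmxN) -!scalemxAr !(dotpDl, dotpDr, dotpNl, dotpNr, dotpZl, dotpZr).
rewrite !(dotpC (A^T *m _)) -!dotp_mull.
rewrite !(dotpC x' xh, dotpC x xh, dotpC x' x, dotpC y' yh, dotpC y yh, dotpC y' y).
rewrite !mulrDr !mulrN; lra.
Qed.

Local Notation it z i := (iter i step z).

Lemma iter_nonneg z i : nonneg z.1 -> nonneg (it z i).1.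
Proof. by case: i => // i _; rewrite iterS; exact: step_nonneg. Qed.

(** Summing [step_gap] over the iterates telescopes. *)
Lemma average_gap z zh K : (0 < K)%N -> nonneg zh.1 ->
  gap (avg z K) zh <= pform 1 (zh - z) (zh - z) / (2 * K%:R).
Proof.
move=> K_gt0 zh0; have K_gt0' : 0 < K%:R :> R by rewrite ltr0n.
suff : K%:R * gap (avg z K) zh <= pform 1 (zh - z) (zh - z) / 2.
  by move=> H; rewrite [(2 * K%:R)^-1]invfM [leRHS]mulrA ler_pdivlMr // mulrC.
rewrite gap_average //.
suff : \sum_(1 <= i < K.+1) gap (it z i) zh <=
    (pform 1 (zh - z) (zh - z) - pform 1 (zh - it z K) (zh - it z K)) / 2.
  by have := pform_ge0 sqr_sgn1 (zh - it z K); lra.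
elim: K {K_gt0 K_gt0'} => [|K IHK]; first by rewrite big_nil subrr mul0r.
rewrite big_nat_recr //=; apply: le_trans (lerD IHK (step_gap _ zh0)) _.
by rewrite le_eqVlt; apply/orP; left; apply/eqP; lra.
Qed.

(* Along the segment from [z] the gap is linear while its bound
   [average_gap] is quadratic. *)
Lemma average_stationary z K : (0 < K)%N -> nonneg z.1 -> avg z K = z ->
  saddle_point A b c z.
Proof.
move=> K_gt0 z0 avgz; apply: gap_saddle => // zh zh0.
rewrite leNgt; apply/negP => g_gt0.
set P := pform 1 (zh - z) (zh - z).
have P0 : 0 <= P := pform_ge0 sqr_sgn1 _.
(* This [t] is at most [1] and makes [t * P] smaller than the gap, whereas [average_gap] would bound
   the gap by [t * P / (2 K)]. *)
pose t := gap z zh / (gap z zh + P).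
have D_gt0 : 0 < gap z zh + P by rewrite ltr_pwDl.
have t_gt0 : 0 < t by rewrite divr_gt0.
have t_le1 : t <= 1 by rewrite ler_pdivrMr // mul1r lerDl.
have /(average_gap z K_gt0) : nonneg (z + t *: (zh - z)).1.
  by apply: nonneg_segment => //; rewrite ltW.
rewrite avgz gap_segment [_ + _ - z]addrAC subrr add0r pformZl pformC pformZl -/P.
rewrite -mulrA ler_pM2l // ler_pdivlMr ?mulr_gt0 ?ltr0n // leNgt => /negP; apply.
have tP : t * P < gap z zh by rewrite /t mulrAC ltr_pdivrMr // ltr_pM2l // ltr_pwDl.
apply: lt_le_trans tP _; rewrite ler_peMr ?(ltW g_gt0) //.
by rewrite -natrM ler1n muln_gt0.
Qed.

Section Nonexpansive.
Variable zs : pd.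
Hypotheses (zs_ge0 : nonneg zs.1)
  (zs_gap : forall z, nonneg z.1 -> 0 <= gap z zs).

(** In [step_gap] at [zs] the left side is nonnegative, so no step increases the distance. *)
Lemma iter_dist z i : pn (it z i - zs) <= pn (z - zs).
Proof.
elim: i => // i; apply: le_trans; rewrite iterS.
rewrite -(ler_pXn2r (n := 2)) ?nnegrE ?pnorm_ge0 //.
rewrite ![pn (_ - zs)]pnorm_distC !(pnorm_sqr sqr_sgn1).
have := zs_gap (step_nonneg (it z i)); have := step_gap (it z i) zs_ge0; lra.
Qed.

Lemma average_dist z K : (0 < K)%N -> pn (avg z K - zs) <= pn (z - zs).
Proof.
move=> K_gt0; have K_gt0' : 0 < K%:R :> R by rewrite ltr0n.
have -> : avg z K - zs = K%:R^-1 *: \sum_(1 <= i < K.+1) (it z i - zs).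
  rewrite big_split /= sumr_const_nat subn1 /= scalerDr; congr (_ + _).
  by rewrite -(scaler_nat K (- zs)) scalerA mulVf ?scale1r // gt_eqF.
rewrite (pnormZ 1) ger0_norm ?invr_ge0 ?(ltW K_gt0') // ler_pdivrMl //.
apply: le_trans (form_norm_sum _ _ _ _ _ _) _;
  [exact: pformDl|exact: pformZl|exact: pformC|exact: (pform_ge0 sqr_sgn1)|].
apply: (@le_trans _ _ (\sum_(1 <= i < K.+1) pn (z - zs))).
  by apply: ler_sum => i _; exact: iter_dist.
by rewrite sumr_const_nat subn1 mulr_natl.
Qed.

Lemma average_move z K : (0 < K)%N -> nM (avg z K - z) <= 4 * pn (z - zs).
Proof.
move=> K_gt0; apply: le_trans (normM_le _) _.
have := pnorm_dist sqr_sgn1 (avg z K) zs z; have := average_dist z K_gt0.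
by rewrite (pnorm_distC 1 zs); lra.
Qed.

End Nonexpansive.

Lemma average_nonneg z K : nonneg z.1 -> nonneg (avg z K).1.
Proof.
move=> z0 i; rewrite /average /= mxE mulr_ge0 ?invr_ge0 //.
rewrite (raddf_sum fst) summxE sumr_ge0 // => j _; exact: iter_nonneg.
Qed.

(** * The normalized duality gap *)

Local Notation rhoz := (rho A b c tau sigma).

Local Open Scope classical_set_scope.

Lemma normM_ge0 z : 0 <= nM z. Proof. exact: sqrtr_ge0. Qed.

Lemma normM_subrr z : nM (z - z) = 0.
Proof.
rewrite subrr normME /pnorm /form_norm /pform /= mulmx0 !dotp0l.
by rewrite !(mulr0, addr0) sqrtr0.
Qed.

(** Boundedness ensures that the [sup] in [rho] dominates the gap values. The gap is linear in
    [zh - z], and the norm controls both components. *)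
Lemma rho_set_bounded r z : has_ubound
  [set lagrangian A b c z.1 zh.2 - lagrangian A b c zh.1 z.2 | zh in
    [set zh : pd | nonneg zh.1 /\ nM (zh - z) <= r]].
Proof.
have k_gt0 : 0 < Num.sqrt kap by rewrite sqrtr_gt0.
exists (norm2 (b - A *m z.1) * (r / (Num.sqrt kap * l)) +
        norm2 (c - A^T *m z.2) * (r / Num.sqrt kap)) => _ [zh /= [zh0 zhr] <-].
rewrite -/(gap z zh) gapE -dotpNr; rewrite normME in zhr.
apply: lerD; apply: le_trans (dotp_le_norm2 _ _) _;
  rewrite ler_wpM2l ?norm2_ge0 // ler_pdivlMr ?mulr_gt0 //.
- by rewrite mulrC -mulrA; apply: le_trans (pnorm_ge_dual sqr_sgnN1 (zh - z)) zhr.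
- rewrite norm2N mulrC.
  exact: le_trans (pnorm_ge_primal sqr_sgnN1 (zh - z)) zhr.
Qed.

(** Shrink [zh] towards [z] by the factor [r / r']: the point enters the ball of radius [r], stays
    nonnegative, and the gap shrinks by the same factor. Test points outside the ball thus become
    usable. *)
Lemma gap_le_rho z zh r r' : nonneg z.1 -> nonneg zh.1 -> 0 < r -> r <= r' ->
  nM (zh - z) <= r' -> gap z zh <= r' * rhoz r z.
Proof.
move=> z0 zh0 r_gt0 rr' zhr.
have r'_gt0 : 0 < r' := lt_le_trans r_gt0 rr'.
have t_ge0 : 0 <= r / r' by rewrite divr_ge0 ?ltW.
have : r / r' * gap z zh <= sup
    [set lagrangian A b c z.1 zh.2 - lagrangian A b c zh.1 z.2 | zh in
      [set zh : pd | nonneg zh.1 /\ nM (zh - z) <= r]].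
  apply: (ub_le_sup (rho_set_bounded r z)); rewrite -gap_segment.
  exists (z + (r / r') *: (zh - z)) => //; split.
    by apply: nonneg_segment => //; rewrite t_ge0 ler_pdivrMr ?mul1r.
  rewrite addrAC subrr add0r normME (pnormZ (-1)) -normME ger0_norm //.
  by rewrite mulrAC ler_pdivrMr // ler_pM2l.
by move=> H; rewrite /rho [leRHS]mulrA -(invf_div r r') ler_pdivlMl // divr_gt0.
Qed.

(** Points within [r] of the average lie within [4 r] of [z] in the proximal norm, so [average_gap]
    bounds the gap by [8 r^2 / K]. After division by [r], [average_move] replaces [r] by four times
    the distance. *)
Lemma rho_average z K zs : (0 < K)%N -> nonneg z.1 -> nonneg zs.1 ->
  (forall z, nonneg z.1 -> 0 <= gap z zs) ->
  rhoz (nM (avg z K - z)) (avg z K) <= 32 * pn (z - zs) / K%:R.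
Proof.
move=> K_gt0 z0 zs0 zs_gap; set r := nM _.
have K_gt0' : 0 < K%:R :> R by rewrite ltr0n.
have r_ge0 : 0 <= r := normM_ge0 _.
apply: (@le_trans _ _ (8 * r / K%:R)); last first.
  rewrite ler_pM2r ?invr_gt0 //.
  have := average_move zs0 zs_gap z K_gt0; rewrite -/r; lra.
(* For [r = 0] the inverse has the value [0], so [rho] is [0]. *)
have [r0|r_neq0] := eqVneq r 0; first by rewrite /rho r0 invr0 mul0r mulr0 mul0r.
rewrite /rho ler_pdivrMl ?lt_def ?r_neq0 //; apply: ge_sup.
  exists (gap (avg z K) (avg z K)), (avg z K) => //; split.
    exact: average_nonneg.
  by rewrite normM_subrr.
move=> _ [zh [zh0 zhr] <-].
apply: le_trans (average_gap z K_gt0 zh0) _; rewrite -(pnorm_sqr sqr_sgn1).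
have H : pn (zh - z) <= 4 * r.
  apply: le_trans (pnorm_le_normM _) _; rewrite normME.
  have := pnorm_dist sqr_sgnN1 zh (avg z K) z; rewrite -!normME -/r; lra.
rewrite invfM !mulrA ler_pM2r ?invr_gt0 //.
have := pnorm_ge0 1 (zh - z); nra.
Qed.

End PDHG.

(** * Runs of the restarted method *)

Section Runs.
Context {R : realType} {m n : nat}.
Variables (A : 'M[R]_(m, n)) (b : 'cV[R]_m) (c : 'cV[R]_n).

Section Generic.
Variables tau sigma beta : R.
Local Notation run := (rPDHG_run A b c tau sigma beta).
Local Notation avg := (average A b c tau sigma).

Lemma first_restart_inj t zp z k k' :
  first_restart A b c tau sigma beta t zp z k ->
  first_restart A b c tau sigma beta t zp z k' -> k = k'.
Proof.
move=> [k1 [rk min_k]] [k1' [rk' min_k']]; apply/eqP; rewrite eqn_leq.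
apply/andP; split; rewrite leqNgt; apply/negP => lt_k.
- by apply: (min_k k') => //; rewrite k1'.
- by apply: (min_k' k) => //; rewrite k1.
Qed.

Lemma run_inj t zp z T zp' z' T' : run t zp z T -> run t zp' z' T' ->
  [/\ zp = zp', z = z' & T = T'].
Proof.
move=> H; elim: H zp' z' T' => [|{}t {}zp {}z {}T k _ IH _ rk] zp' z' T'.
  by move=> H; inversion H.
move=> H; inversion H as [|t0 zp0 z0 T0 k0 run0 _ rk0]; subst.
have [? ? ?] := IH _ _ _ run0; subst.
by rewrite (first_restart_inj rk rk0).
Qed.

Lemma run_pred t zp z T : run t.+1 zp z T -> exists zpp T', run t zpp zp T'.
Proof. by move=> H; inversion H; subst; exists zprev, T0. Qed.

(** A run never restarts from a saddle point and runs are deterministic, so no iterate follows one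
    and [t' = t]. *)
Lemma run_after_saddle t zp z T t' zp' z' T' : run t zp z T ->
  saddle_point A b c z -> run t' zp' z' T' -> (t <= t')%N -> z' = z.
Proof.
move=> run_t sz; elim=> [|{}t' {}zp' {}z' {}T' k run' IH nsz rk].
  by rewrite leqn0 => /eqP t0; move: run_t; rewrite t0 => H; inversion H.
rewrite leq_eqVlt => /predU1P [tt'|]; last first.
  by rewrite ltnS => /IH zz; case: nsz; rewrite zz.
move: run_t; rewrite tt' => run_t.
by have [] := run_inj run_t (rPDHG_restart run' nsz rk).
Qed.

End Generic.

(** * Run lengths under a sharpness hypothesis *)

Variables (a l beta L P : R) (zs : 'cV[R]_n * 'cV[R]_m).
Hypotheses (l_gt0 : 0 < l) (le_la : l <= a)
  (A_le : forall x : 'cV[R]_n, norm2 (A *m x) <= a * norm2 x).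
Local Notation kap := (a / l).
Local Notation tau := ((2 * kap)^-1).
Local Notation sigma := ((2 * a * l)^-1).
Local Notation run := (rPDHG_run A b c tau sigma beta).
Local Notation avg := (average A b c tau sigma).
Local Notation pn := (pnorm A a l 1).
Local Notation nM := (normM A tau sigma).
Local Notation rhoz := (rho A b c tau sigma).
Local Notation restart := (first_restart A b c tau sigma beta).
Hypotheses (beta_gt0 : 0 < beta) (zs_ge0 : nonneg zs.1)
  (zs_gap : forall z, nonneg z.1 -> 0 <= gap A b c z zs)
  (zs_le : pn zs <= P) (L_ge0 : 0 <= L)
  (sharp : forall z r, nonneg z.1 -> 0 < r -> r <= 4 * P -> pn (z - zs) <= P ->
    pn (z - zs) <= L * rhoz r z).

Lemma run_dist t zp z T : run t zp z T -> nonneg z.1 /\ pn (z - zs) <= P.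
Proof.
elim=> [|{}t {}zp {}z {}T k _ [z0 zP] _ [k1 _]].
  split=> [i|]; first by rewrite /= mxE.
  by rewrite pnorm_distC subr0.
split; first exact: average_nonneg.
exact: le_trans (average_dist l_gt0 le_la A_le zs_ge0 zs_gap z k1) zP.
Qed.

(** Loop [0] gives [32 P] by [rho_average], and each later restart condition contributes a factor
    [beta]. The displacement is positive since a stationary start would be a saddle point, from
    which no restart occurs. *)
Lemma run_succ t zp z T : run t.+1 zp z T ->
  [/\ 0 < nM (z - zp), nM (z - zp) <= 4 * pn (zp - zs),
      pn (z - zs) <= pn (zp - zs) & rhoz (nM (z - zp)) z <= 32 * P * beta ^+ t].
Proof.
elim: t zp z T => [|t IH] zp z T H;
  inversion H as [|t0 zpp z0 T0 k run0 nsz [k1 [rk _]]]; subst;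
  have [zp0 zpP] := run_dist run0.
all: have k_gt0 : 0 < k%:R :> R by rewrite ltr0n.
all: have move_le := average_move l_gt0 le_la A_le zs_ge0 zs_gap zp k1.
all: have dist_le := average_dist l_gt0 le_la A_le zs_ge0 zs_gap zp k1.
all: have move_gt0 : 0 < nM (avg zp k - zp).
1,3: rewrite lt_def normM_ge0 andbT; apply/eqP; rewrite normME => avg0; apply: nsz;
  apply: (average_stationary l_gt0 le_la A_le k1) => //; apply/eqP;
  rewrite -subr_eq0; apply/eqP; exact: (pnorm_eq0 l_gt0 le_la A_le sqr_sgnN1).
all: split=> //.
- apply: le_trans (rho_average l_gt0 le_la A_le k1 zp0 zs_ge0 zs_gap) _.
  rewrite expr0 mulr1 ler_pdivrMr //; apply: (@le_trans _ _ (32 * P)).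
    by rewrite ler_pM2l.
  rewrite ler_peMr ?ler1n // mulr_ge0 //.
  by apply: le_trans zs_le; exact: pnorm_ge0.
- have [_ _ _ rho_zp] := IH _ _ _ run0.
  case: rk => [[]|[_ rk]] //; apply: le_trans rk _.
  by rewrite exprS [leRHS]mulrCA ler_pM2l.
Qed.

Lemma first_restart_exists t zp z k :
  (0 < k)%N -> restart_condition A b c tau sigma beta t zp z k ->
  exists2 k', (k' <= k)%N & restart t zp z k'.
Proof.
move=> k_gt0 rk.
pose Q j := (0 < j)%N && `[< restart_condition A b c tau sigma beta t zp z j >].
have exQ : exists j, Q j by exists k; rewrite /Q k_gt0; apply/asboolP.
have /andP [j_gt0 /asboolP rj] := xchooseP exQ.
case: (ex_minnP exQ) => j' /andP [j'_gt0 /asboolP rj'] j'_min.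
exists j'; first by apply: j'_min; rewrite /Q k_gt0; apply/asboolP.
split=> //; split=> // i /andP [i_gt0 ij] ri.
have : (j' <= i)%N by apply: j'_min; rewrite /Q i_gt0; apply/asboolP.
by rewrite leqNgt ij.
Qed.

(** By [rho_average], [K] iterations bring the normalized gap below [32 X / K] times its value at
    the start of the loop, so the first [K] above [32 X / beta] satisfies the restart condition. *)
Lemma restart_length X t zp z T : 0 <= X -> run t.+1 zp z T ->
  pn (z - zs) <= X * rhoz (nM (z - zp)) z ->
  exists2 k, k%:R <= 32 * X / beta + 1 & restart t.+1 zp z k.
Proof.
move=> X0 run_t zX; have [z0 _] := run_dist run_t.
set Y := 32 * X / beta.
have Y0 : 0 <= Y by rewrite divr_ge0 ?mulr_ge0 // ltW.
pose K := (Num.truncn Y).+1.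
have /andP [K_le K_gt] := truncn_itv Y0.
have [|k k_le rk] := @first_restart_exists t.+1 zp z K isT.
  right; split=> //.
  apply: le_trans (rho_average l_gt0 le_la A_le (K := K) isT z0 zs_ge0 zs_gap) _.
  rewrite ler_pdivrMr ?ltr0n //.
  set q := rhoz _ z in zX *; have z_ge0 : 0 <= pn (z - zs) by exact: pnorm_ge0.
  (* A negative [rho] is impossible because [z] itself is a test point of gap zero. *)
  have [q_ge0|q_lt0] := leP 0 q; last first.
    have /eqP : pn (z - zs) = 0.
      by apply/eqP; rewrite eq_le z_ge0 andbT (le_trans zX) // mulr_ge0_le0 // ltW.
    move=> /eqP zs0; exfalso.
    have : 0 <= q; last by rewrite leNgt q_lt0.
    have [r_gt0 _ _ _] := run_succ run_t.
    rewrite -(pmulr_rge0 _ r_gt0) -[X in X <= _](subrr (lagrangian A b c z.1 z.2)).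
    apply: (gap_le_rho b c l_gt0 le_la A_le z0 z0) => //.
    by rewrite normM_subrr normM_ge0.
  apply: (@le_trans _ _ (beta * q * Y)); last first.
    by rewrite ler_wpM2l ?(mulr_ge0 (ltW beta_gt0) q_ge0) // ltW.
  have -> : beta * q * Y = 32 * (X * q) by rewrite /Y; field; rewrite gt_eqF.
  by rewrite ler_pM2l.
exists k => //; apply: (@le_trans _ _ K%:R); first by rewrite ler_nat.
by rewrite -natr1 lerD2r.
Qed.

Lemma run_start_restart zp z T : run 0 zp z T -> restart 0 zp z 1.
Proof.
move=> _; split=> //; split; first by left.
by move=> [|j] /andP [].
Qed.

Lemma run_restart_length t zp z T : run t zp z T ->
  exists2 k, k%:R <= 32 * L / beta + 1 & restart t zp z k.
Proof.
case: t => [|t] run_t.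
  exists 1%N; last exact: run_start_restart run_t.
  by rewrite lerDr divr_ge0 ?mulr_ge0 // ltW.
apply: (restart_length L_ge0 run_t).
have [z0 zP] := run_dist run_t; have [r_gt0 r_le _ _] := run_succ run_t.
apply: sharp => //; apply: le_trans r_le _; rewrite ler_pM2l //.
by have [? [? /run_dist []]] := run_pred run_t.
Qed.

(** Every inner loop ends by [run_restart_length], so only an earlier saddle point can prevent loop
    [N] from being reached. *)
Lemma run_exists N : (exists zp z T, run N zp z T) \/
  (exists t zp z T, [/\ (t < N)%N, run t zp z T & saddle_point A b c z]).
Proof.
elim: N => [|N [[zp [z [T run_N]]]|[t [zp [z [T [tN run_t sz]]]]]]].
- by left; exists 0, 0, 0%N; exact: rPDHG_start.
- have [sz|nsz] := pselect (saddle_point A b c z).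
    by right; exists N, zp, z, T.
  have [k _ rk] := run_restart_length run_N.
  by left; exists z, (avg z k), (T + k)%N; exact: rPDHG_restart run_N nsz rk.
- by right; exists t, zp, z, T; split=> //; exact: ltnW.
Qed.

Lemma run_length t zp z T : run t zp z T ->
  T%:R <= t%:R * (32 * L / beta + 1).
Proof.
elim=> [|{}t {}zp {}z {}T k run_t IH _ rk]; first by rewrite mul0r.
have [k' k'_le rk'] := run_restart_length run_t.
by rewrite (first_restart_inj rk rk') natrD -natr1 mulrDl mul1r lerD.
Qed.

(** Loops that start at an index of at most [N] are charged with the global constant [L], the
    remaining [t - (N + 1)] ones with the local constant [X]. *)
Lemma run_length_local X N t zp z T : 0 <= X ->
  (forall t zp z T, (N < t)%N -> run t zp z T ->
    pn (z - zs) <= X * rhoz (nM (z - zp)) z) ->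
  run t zp z T -> (N < t)%N ->
  T%:R <= N.+1%:R * (32 * L / beta + 1) + (t - N.+1)%:R * (32 * X / beta + 1).
Proof.
move=> X0 HX; elim=> [//|{}t {}zp {}z {}T k run_t IH nsz rk].
rewrite ltnS leq_eqVlt => /predU1P [->|Nt].
  by rewrite subnn mul0r addr0; apply: run_length (rPDHG_restart run_t nsz rk).
case: t Nt run_t IH rk => // t Nt run_t IH rk.
have [k' k'_le rk'] := restart_length X0 run_t (HX _ _ _ _ Nt run_t).
have -> : (t.+2 - N.+1)%:R = (t.+1 - N.+1)%:R + 1 :> R by rewrite subSn // natr1.
rewrite (first_restart_inj rk rk') natrD [X in _ <= _ + X]mulrDl mul1r addrA.
by rewrite lerD // IH.
Qed.

End Runs.

(** * Sharpness of the normalized duality gap *)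

Section Sharpness.
Context {R : realType} {m p : nat}.

Lemma dotp_unit_vector k (v : 'cV[R]_k) :
  exists u, norm2 u <= 1 /\ dotp v u = norm2 v.
Proof.
exists ((norm2 v)^-1 *: v).
rewrite norm2Z ger0_norm ?invr_ge0 ?norm2_ge0 // dotpZr -norm2_sqr expr2 mulrA.
have [->|v0] := eqVneq (norm2 v) 0; first by rewrite !mulr0 ler01.
by rewrite mulVf ?mul1r.
Qed.

Variables (A : 'M[R]_(m, m + p)) (b : 'cV[R]_m) (c xs ss : 'cV[R]_(m + p)).
Variables (ys : 'cV[R]_m) (a l mu : R).
Let B := basis_mx A.
Let N := nonbasis_mx A.
Let D := invmx B *m N.
Hypotheses (l_gt0 : 0 < l) (le_la : l <= a)
  (A_le : forall x : 'cV[R]_(m + p), norm2 (A *m x) <= a * norm2 x)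
  (AT_ge : forall y : 'cV[R]_m, l * norm2 y <= norm2 (A^T *m y)).
Hypotheses (Bu : B \in unitmx) (Axs : A *m xs = b) (ATys : A^T *m ys + ss = c)
  (xs_gt0 : forall i, 0 < xs (lshift p i) 0)
  (ss_eq0 : forall i, ss (lshift p i) 0 = 0)
  (xs_eq0 : forall j, xs (rshift m j) 0 = 0)
  (ss_gt0 : forall j, 0 < ss (rshift m j) 0).
Hypotheses (mu_gt0 : 0 < mu)
  (row_le : forall i, Num.sqrt (norm2 (row i D) ^+ 2 + 1) <= mu * xs (lshift p i) 0)
  (col_le : forall j, Num.sqrt (norm2 (col j D) ^+ 2 + 1) <= mu * ss (rshift m j) 0).

Local Notation pd := ('cV[R]_(m + p) * 'cV[R]_m)%type.
Local Notation kap := (a / l).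
Local Notation k := (Num.sqrt kap).
Local Notation tau := ((2 * kap)^-1).
Local Notation sigma := ((2 * a * l)^-1).
Local Notation step := (onePDHG A b c tau sigma).
Local Notation pn := (pnorm A a l 1).
Local Notation nM := (normM A tau sigma).
Local Notation rhoz := (rho A b c tau sigma).
Local Notation gapz := (gap A b c).
Local Notation zs := (xs, ys).
Local Notation slack z := (c - A^T *m z.2).

Let W := norm1 xs + norm1 ss.
Let a_gt0 : 0 < a. Proof. exact: lt_le_trans le_la. Qed.
Let kap_gt0 : 0 < kap. Proof. exact: divr_gt0. Qed.
Let kap_ge1 : 1 <= kap. Proof. by rewrite ler_pdivlMr // mul1r. Qed.
Let k_gt0 : 0 < k. Proof. by rewrite sqrtr_gt0. Qed.
Let kK : k * k = kap. Proof. by rewrite -expr2 sqr_sqrtr // ltW. Qed.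
Let k_ge1 : 1 <= k. Proof. by have := ler_wsqrtr kap_ge1; rewrite sqrtr1. Qed.
Let W_ge0 : 0 <= W. Proof. by rewrite addr_ge0 ?norm1_ge0. Qed.

Lemma xs_ge0 : nonneg xs.
Proof.
by move=> i; case: (split_ordP i) => j ->; [exact/ltW/xs_gt0|rewrite xs_eq0].
Qed.

Lemma ss_ge0 : nonneg ss.
Proof.
by move=> i; case: (split_ordP i) => j ->; [rewrite ss_eq0|exact/ltW/ss_gt0].
Qed.

Lemma xs_ss_orth : dotp xs ss = 0.
Proof.
rewrite dotpE big1 // => i _.
by case: (split_ordP i) => j ->; rewrite ?ss_eq0 ?xs_eq0 ?mulr0 ?mul0r.
Qed.

Lemma slackE (z : pd) : slack z = ss - A^T *m (z.2 - ys).
Proof. by rewrite mulmxBr -ATys opprB addrCA addrA. Qed.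

Lemma slack_basic (z : pd) : usubmx (slack z) = - (B^T *m (z.2 - ys)).
Proof.
apply/matrixP => i j; rewrite ord1 mxE slackE trmx_basis -/B -/N.
by rewrite mxE ss_eq0 add0r mxE col_mxEu [RHS]mxE.
Qed.

Lemma trmx_basis_inv (v : 'cV[R]_m) :
  A^T *m (invmx B^T *m v) = col_mx 1%:M D^T *m v.
Proof.
have BTu : B^T \in unitmx by rewrite unitmx_tr.
rewrite trmx_basis -/B -/N mulmxA mulmxV // mul1mx mul_col_mx mul1mx.
by rewrite /D trmx_mul -[invmx B]trmxK trmx_inv trmxK mulmxA.
Qed.

(** The columns of [(1; D^T)] are the rows of [(1, D)], whose norms are at most [mu] times the basic
    entries of [xs]. *)
Lemma norm2_trmx_basis_inv (v : 'cV[R]_m) :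
  norm2 (A^T *m (invmx B^T *m v)) <= mu * \sum_i `|v i 0| * xs (lshift p i) 0.
Proof.
rewrite trmx_basis_inv; apply: le_trans (norm2_mulmx_col _ _) _.
rewrite mulr_sumr; apply: ler_sum => i _.
rewrite mulrCA ler_wpM2l //; apply: le_trans (row_le i).
rewrite -(ler_pXn2r (n := 2)) ?nnegrE ?norm2_ge0 ?sqrtr_ge0 //.
rewrite col_col_mx norm2_col_mx addrC [leRHS]sqr_sqrtr ?addr_ge0 ?sqr_ge0 //.
rewrite lerD //; last first.
  by rewrite norm2_sqr dotpE (bigD1 i) //= big1 ?mxE ?eqxx ?mulr1 ?addr0 //
    => j ji; rewrite !mxE (negPf ji) mul0r.
rewrite -tr_row /norm2 !sqr_sqrtr ?sumr_ge0 // => [|j _|j _].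
- by rewrite exchange_big /= le_eqVlt; apply/orP; left; apply/eqP;
    do 2!(apply: eq_bigr => ? _); rewrite mxE.
- by rewrite sumr_ge0 // => ? _; rewrite sqr_ge0.
- by rewrite sumr_ge0 // => ? _; rewrite sqr_ge0.
Qed.

(** Pass to the transpose: [l |B^-T v| <= |A^T B^-T v|], and the preceding bound applies with
    [|v_i| <= |v|]. Multiplied by [a], the constant becomes [kap * (W * mu)]. *)
Lemma norm2_basis_inv (v : 'cV[R]_m) :
  norm2 (invmx B *m v) <= W * mu / l * norm2 v.
Proof.
have C0 : 0 <= W * mu / l by rewrite !mulr_ge0 ?invr_ge0 ?(ltW mu_gt0) ?(ltW l_gt0).
rewrite -[invmx B]trmxK; apply: norm2_trmx_bound C0 _ v => v.
rewrite trmx_inv mulrAC ler_pdivlMr // mulrC.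
apply: le_trans (AT_ge _) _; apply: le_trans (norm2_trmx_basis_inv _) _.
rewrite [W * mu]mulrC -mulrA ler_pM2l // mulrC.
apply: (@le_trans _ _ (\sum_i norm2 v * xs (lshift p i) 0)).
  by apply: ler_sum => i _; rewrite ler_wpM2r ?norm2_coord ?(ltW (xs_gt0 i)).
rewrite -mulr_sumr ler_wpM2l ?norm2_ge0 // /W /norm1 big_split_ord /=.
rewrite -[leLHS]addr0 -addrA lerD ?addr_ge0 ?sumr_ge0 //.
by apply: ler_sum => i _; exact: ler_norm.
Qed.

(** Decompose [x - xs] as [(-D; 1) x_N + (B^-1 A (x - xs); 0)]. Column [j] of [(-D; 1)] has norm at
    most [mu * s_j], and the products [x_j s_j] add up to [x^T ss]. *)
Lemma norm2_primal_dist (x : 'cV[R]_(m + p)) : nonneg x ->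
  norm2 (x - xs) <= mu * dotp x ss + norm2 (invmx B *m (A *m (x - xs))).
Proof.
move=> x_ge0; pose xN := dsubmx x.
have xE : x - xs = col_mx (- D) 1%:M *m xN + col_mx (invmx B *m (A *m (x - xs))) 0.
  rewrite -[x - xs in LHS]vsubmxK -[x - xs in RHS]vsubmxK mulmx_basis -/B -/N.
  have -> : dsubmx (x - xs) = xN.
    by apply/matrixP => i j; rewrite !mxE ord1 xs_eq0 subr0.
  rewrite mulmxDr !mulmxA mulVmx // mul1mx mul_col_mx mul1mx add_col_mx addr0.
  by rewrite mulNmx addrCA addNr addr0.
rewrite [x - xs in leLHS]xE.
apply: le_trans (norm2D _ _) _; apply: lerD; last first.
  by apply: le_trans (norm2_col_mx_le _ _) _; rewrite norm20 addr0.
apply: le_trans (norm2_mulmx_col _ _) _.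
have -> : dotp x ss = \sum_j x (rshift m j) 0 * ss (rshift m j) 0.
  by rewrite dotpE big_split_ord /= big1 ?add0r // => i _; rewrite ss_eq0 mulr0.
rewrite mulr_sumr; apply: ler_sum => j _.
rewrite mxE ger0_norm ?x_ge0 // mulrCA ler_wpM2l //; apply: le_trans (col_le j).
rewrite -(ler_pXn2r (n := 2)) ?nnegrE ?norm2_ge0 ?sqrtr_ge0 //.
rewrite col_col_mx norm2_col_mx [leRHS]sqr_sqrtr ?addr_ge0 ?sqr_ge0 //.
rewrite lerD //; last first.
  by rewrite norm2_sqr dotpE (bigD1 j) //= big1 ?mxE ?eqxx ?mulr1 ?addr0 //
    => i ij; rewrite !mxE (negPf ij) mul0r.
have -> : col j (- D) = - col j D by apply/matrixP => i ?; rewrite !mxE.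
by rewrite norm2N.
Qed.

(** The bilinear parts cancel and [xs] is orthogonal to [ss]. *)
Lemma gap_optimal z : gapz z zs = dotp z.1 ss.
Proof.
rewrite gapE slackE /= -[b]Axs -mulmxBr dotp_mull !dotpB.
have := xs_ss_orth.
set u := A^T *m _; set v := A^T *m _.
have -> : v = - u by rewrite /v /u -mulmxN opprB.
rewrite !dotpB !(dotpC ss) !(dotpC u) => ->; ring.
Qed.

Lemma gap_optimal_ge0 z : nonneg z.1 -> 0 <= gapz z zs.
Proof.
by move=> z0; rewrite gap_optimal dotpE sumr_ge0 // => i _; rewrite mulr_ge0 ?z0 ?ss_ge0.
Qed.

(** It dominates the Euclidean distance of [(x, c - A^T y)] to the optimal pair, and by [AT_ge] it
    also controls [y - ys]. *)
Definition kkt_dist (z : pd) := norm2 (z.1 - xs) + norm2 (slack z - ss).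

Lemma slack_dist (z : pd) : slack z - ss = - (A^T *m (z.2 - ys)).
Proof. by rewrite slackE addrAC subrr add0r. Qed.

Lemma dual_dist_le (z : pd) : l * norm2 (z.2 - ys) <= norm2 (slack z - ss).
Proof. by rewrite slack_dist norm2N AT_ge. Qed.

Lemma pnorm_kkt_dist z : pn (z - zs) <= 2 * k * kkt_dist z.
Proof.
apply: le_trans (pnorm_le l_gt0 le_la A_le sqr_sgn1 _) _.
by rewrite ler_pM2l ?mulr_gt0 // lerD2l dual_dist_le.
Qed.

(* The test point moves [x*] by [- sg s_i x*_i] in each coordinate and [y*]
   along [A (x* - x)], so that every infeasibility contributes to the gap. *)
Lemma kkt_dist_le_gap z : nonneg z.1 -> exists zh, [/\ nonneg zh.1,
  nM (zh - zs) <= 4 * k * W & kkt_dist z <= mu * gapz z zh].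
Proof.
move=> z0; pose s := slack z; pose r := A *m (z.1 - xs).
pose dx : 'cV[R]_(m + p) := \col_i (Num.sg (s i 0) * xs i 0).
have [u [u1 ru]] := dotp_unit_vector r.
(* The length [W / l] is the constant of [norm2_basis_inv] without [mu], so that the residual term
   of the gap pays for [|B^-1 r|]. *)
pose zh : pd := (xs - dx, ys - (W / l) *: u).
have gapzh : gapz z zh = W / l * norm2 r + dotp z.1 ss + dotp s dx.
  have -> : gapz z zh = gapz z zs + (W / l * norm2 r + dotp s dx).
    rewrite !gapE /= -/s -ru.
    have -> : b - A *m z.1 = - r by rewrite /r mulmxBr Axs opprB.
    by rewrite !dotpB !dotpZr; ring.
  by rewrite gap_optimal; ring.
have sdx : dotp s dx = \sum_i `|s (lshift p i) 0| * xs (lshift p i) 0.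
  rewrite dotpE big_split_ord /= [X in _ + X]big1 => [|j _]; last first.
    by rewrite [dx _ _]mxE xs_eq0 !mulr0.
  rewrite addr0; apply: eq_bigr => i _.
  by rewrite [dx _ _]mxE mulrA normrEsg [_ * Num.sg _]mulrC.
exists zh; split.
- move=> i; rewrite /= !mxE -[X in X - _]mul1r -mulrBl mulr_ge0 ?xs_ge0 // subr_ge0.
  by apply: le_trans (ler_norm _) _; rewrite normr_sg lern1 leq_b1.
- rewrite normME.
  apply: le_trans (pnorm_le l_gt0 le_la A_le sqr_sgnN1 _) _.
  have -> : 4 * k * W = 2 * k * (W + W) by ring.
  rewrite ler_pM2l ?mulr_gt0 // /=.
  rewrite [xs - dx - xs]addrAC [ys - _ - ys]addrAC !subrr !add0r !norm2N norm2Z.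
  rewrite ger0_norm; last first.
    by rewrite divr_ge0 // ltW.
  apply: lerD.
    apply: le_trans (norm2_le_norm1 _) _; rewrite /W -[leLHS]addr0 lerD ?norm1_ge0 //.
    apply: ler_sum => i _; rewrite mxE normrM ler_piMl // normr_sg lern1.
    exact: leq_b1.
  by rewrite mulrA [l * _]mulrC divfK ?gt_eqF // ler_piMr.
- rewrite /kkt_dist gapzh !mulrDr sdx.
  have := norm2_primal_dist z0; rewrite -/r; have := norm2_basis_inv r.
  have := norm2_trmx_basis_inv (usubmx s).
  have -> : A^T *m (invmx B^T *m usubmx s) = slack z - ss.
    by rewrite slack_dist slack_basic mulmxN mulKmx ?unitmx_tr // mulmxN.
  have -> : \sum_i `|usubmx s i 0| * xs (lshift p i) 0 =
            \sum_i `|s (lshift p i) 0| * xs (lshift p i) 0.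
    by apply: eq_bigr => i _; rewrite mxE.
  have -> : W * mu / l * norm2 r = mu * (W / l * norm2 r) by ring.
  lra.
Qed.

Lemma kkt_dist_eq0 z : kkt_dist z <= 0 -> z = zs.
Proof.
move=> d0; have := norm2_ge0 (z.1 - xs); have := norm2_ge0 (slack z - ss).
move: d0; rewrite /kkt_dist => d0 h1 h2.
have x0 : norm2 (z.1 - xs) = 0 by lra.
have s0 : norm2 (slack z - ss) = 0 by lra.
have y0 : norm2 (z.2 - ys) = 0.
  apply/eqP; rewrite eq_le norm2_ge0 andbT -(pmulr_rle0 _ l_gt0) -s0.
  exact: dual_dist_le.
by case: z x0 y0 {d0 h1 h2 s0} => x y /= /norm2_eq0 /subr0_eq -> /norm2_eq0 /subr0_eq ->.
Qed.

(** At a saddle point every gap is nonpositive, while one of them, times [mu], bounds [kkt_dist]. *)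
Lemma saddle_unique z : saddle_point A b c z -> z = zs.
Proof.
move=> sz; have [zh [zh0 _ dz]] := kkt_dist_le_gap (proj1 sz).
apply: kkt_dist_eq0; apply: le_trans dz _.
by rewrite pmulr_rle0 // saddle_gap.
Qed.

(** The test point of [kkt_dist_le_gap] is within [4 k W] of [zs], and so is [z] after the change of
    norm; hence the radius [8 k W] in [gap_le_rho]. *)
Lemma kkt_dist_le_rho z r : nonneg z.1 -> 0 < r -> r <= 8 * k * W ->
  pn (z - zs) <= 2 * k * W -> kkt_dist z <= 8 * k * (W * mu) * rhoz r z.
Proof.
move=> z0 r_gt0 r_le zW; have [zh [zh0 zhW dz]] := kkt_dist_le_gap z0.
apply: le_trans dz _.
have -> : 8 * k * (W * mu) * rhoz r z = mu * (8 * k * W * rhoz r z) by ring.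
rewrite ler_pM2l //; apply: gap_le_rho => //.
have -> : zh - z = (zh - zs) + (zs - z) by rewrite subrKA.
rewrite normME; apply: le_trans (pnormD l_gt0 le_la A_le sqr_sgnN1 _ _) _.
rewrite -!normME; apply: (le_trans (lerD zhW (normM_le l_gt0 le_la A_le _))).
rewrite (pnorm_distC A a l 1 zs); lra.
Qed.

Lemma pnorm_le_rho z r : nonneg z.1 -> 0 < r -> r <= 8 * k * W ->
  pn (z - zs) <= 2 * k * W -> pn (z - zs) <= 16 * (kap * (W * mu)) * rhoz r z.
Proof.
move=> z0 r_gt0 r_le zW; apply: le_trans (pnorm_kkt_dist z) _.
have -> : 16 * (kap * (W * mu)) * rhoz r z = 2 * k * (8 * k * (W * mu) * rhoz r z).
  by rewrite -[X in 16 * (X * _)]kK; ring.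
by rewrite ler_pM2l ?mulr_gt0 // kkt_dist_le_rho.
Qed.

(** This bounds the distance from the starting point. As [A c = 0], the vector [A^T ys] is
    orthogonal to [c = A^T ys + ss], hence no longer than [ss]. *)
Lemma pnorm_optimal : A *m c = 0 -> pn zs <= 2 * k * W.
Proof.
move=> Ac0; apply: le_trans (pnorm_le l_gt0 le_la A_le sqr_sgn1 _) _.
rewrite ler_pM2l ?mulr_gt0 // lerD ?norm2_le_norm1 //.
apply: le_trans (AT_ge _) _; apply: le_trans _ (norm2_le_norm1 _).
have [->|y0] := eqVneq (A^T *m ys) 0; first by rewrite norm20 norm2_ge0.
rewrite -(ler_pM2l (norm2_gt0 y0)) -expr2 norm2_sqr.
rewrite -[X in dotp _ X](addrK ss) ATys dotpB.
have -> : dotp (A^T *m ys) c = 0 by rewrite dotp_mull trmxK Ac0 dotp0r.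
by rewrite add0r; apply: le_trans (dotp_le_norm2 _ _) _; rewrite norm2N.
Qed.

(** * The neighbourhood of the optimum *)

Section Local.
Hypothesis mu_basic : forall i, 1 <= mu * xs (lshift p i) 0.
Hypothesis mu_nonbasic : forall j, 1 <= mu * ss (rshift m j) 0.

Lemma primal_coord z t i : pn (z - zs) <= t -> `|z.1 i 0 - xs i 0| <= t / k.
Proof.
move=> zt; rewrite ler_pdivlMr // mulrC.
apply: le_trans zt; apply: le_trans (pnorm_ge_primal l_gt0 le_la A_le sqr_sgn1 _).
by rewrite ler_pM2l //; apply: le_trans (norm2_coord _ i); rewrite !mxE.
Qed.

Lemma slack_coord (z : pd) t i : pn (z - zs) <= t -> `|slack z i 0 - ss i 0| <= k * t.
Proof.
move=> zt; have -> : slack z i 0 - ss i 0 = (slack z - ss) i 0.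
  by rewrite [RHS]mxE [(- ss) i 0]mxE.
apply: le_trans (norm2_coord _ i) _; rewrite slack_dist norm2N.
apply: le_trans (norm2_trmx_bound (ltW a_gt0) A_le _) _.
have := le_trans (pnorm_ge_dual l_gt0 le_la A_le sqr_sgn1 (z - zs)) zt.
have -> : a * norm2 (z.2 - ys) = k * (k * (l * norm2 (z.2 - ys))).
  by rewrite mulrA kK mulrA divfK ?gt_eqF.
by rewrite ler_pM2l.
Qed.

(** On the basis [xs] is at least [1 / mu], and the coordinate differs from it by at most
    [1 / (4 mu)] because [k >= 1]. *)
Lemma basic_pos z i : pn (z - zs) <= (4 * k * mu)^-1 ->
  (2 * mu)^-1 <= z.1 (lshift p i) 0.
Proof.
move=> /(primal_coord (lshift p i)); rewrite ler_norml => /andP [+ _].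
have : (4 * k * mu)^-1 / k <= (4 * mu)^-1.
  rewrite -invfM lef_pV2 ?posrE ?mulr_gt0 //.
  have -> : 4 * k * mu * k = kap * (4 * mu) by rewrite -[X in _ = X * _]kK; ring.
  by rewrite ler_peMl // mulr_ge0 // ltW.
have : mu^-1 <= xs (lshift p i) 0.
  by rewrite -[mu^-1]mulr1 ler_pdivrMl // mu_basic.
have -> : (2 * mu)^-1 = mu^-1 / 2 by field; rewrite gt_eqF.
have -> : (4 * mu)^-1 = mu^-1 / 4 by field; rewrite gt_eqF.
have : 0 < mu^-1 by rewrite invr_gt0.
lra.
Qed.

(** The slack of [j] is at least [3 / (4 mu)], while [2 kap x_j] is at most [1 / (2 mu)]; the
    gradient step thus leaves nothing positive and the projection clips. *)
Lemma step_nonbasic_eq0 z j : pn (z - zs) <= (4 * k * mu)^-1 ->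
  (step z).1 (rshift m j) 0 = 0.
Proof.
move=> zt; have := slack_coord (rshift m j) zt; have := primal_coord (rshift m j) zt.
rewrite xs_eq0 subr0 ler_norml => /andP [_ zj]; rewrite ler_norml => /andP [sj _].
have muj : mu^-1 <= ss (rshift m j) 0.
  by rewrite -[mu^-1]mulr1 ler_pdivrMl // mu_nonbasic.
rewrite /= mxE [X in Num.max X]mxE [X in _ + X]mxE [X in - X]mxE.
apply/max_idPr; rewrite subr_le0 ler_pdivlMl ?mulr_gt0 ?invr_gt0 //.
move: sj; rewrite (_ : k * (4 * k * mu)^-1 = mu^-1 / 4); last first.
  by field; rewrite !gt_eqF.
have : 2 * kap * z.1 (rshift m j) 0 <= 2 * kap * ((4 * k * mu)^-1 / k).
  by rewrite ler_pM2l ?mulr_gt0 ?invr_gt0.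
rewrite -{2}kK (_ : 2 * (k * k) * _ = mu^-1 / 2); last by field; rewrite !gt_eqF.
have : 0 < mu^-1 by rewrite invr_gt0.
lra.
Qed.

(** Once [x_N = 0], only [A (x - xs)] and the basic slacks need control. Each is tested by a move of
    norm at most [r] along itself, and [B^-1] recovers [x] and [y] from them. *)
Lemma local_pnorm_le_rho z r (S : R) : nonneg z.1 -> 0 < r -> r <= (k * mu)^-1 ->
  pn (z - zs) <= (4 * k * mu)^-1 -> (forall j, z.1 (rshift m j) 0 = 0) ->
  0 <= S -> (forall v : 'cV[R]_m, norm2 (invmx B *m v) <= S * norm2 v) ->
  pn (z - zs) <= 8 * (S * a) * rhoz r z.
Proof.
move=> z0 r_gt0 r_le zt zN0 S0 BS; set s := usubmx (slack z).
have r_ge0 := ltW r_gt0; have l_ge0 := ltW l_gt0.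
have primal : norm2 (A *m (z.1 - xs)) <= 2 * k * l * rhoz r z.
  have [u [u1 ru]] := dotp_unit_vector (A *m (z.1 - xs)).
  have t0 : 0 <= r / (2 * k * l) by rewrite divr_ge0 ?mulr_ge0 // ltW.
  pose zh : pd := (z.1, z.2 - (r / (2 * k * l)) *: u).
  have : gapz z zh <= r * rhoz r z.
    apply: (gap_le_rho b c l_gt0 le_la A_le) => //; rewrite normME.
    apply: le_trans (pnorm_le l_gt0 le_la A_le sqr_sgnN1 _) _ => /=.
    rewrite subrr norm20 add0r addrAC subrr add0r norm2N norm2Z ger0_norm //.
    rewrite mulrA mulrA (_ : 2 * k * l * _ = r); last by field; rewrite !gt_eqF.
    by rewrite ler_piMr.
  rewrite gapE /= -Axs -mulmxBr subrr dotp0r subr0 addrAC subrr add0r.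
  rewrite dotpNr dotpZr -[xs - z.1]opprB mulmxN dotpNl mulrN opprK ru.
  rewrite [X in X <= _ -> _]mulrAC ler_pdivrMr ?mulr_gt0 //.
  by rewrite -[X in _ <= X -> _]mulrA ler_pM2l // [X in _ <= X -> _]mulrC.
have dual : norm2 s <= 2 * k * rhoz r z.
  have [u [u1 ru]] := dotp_unit_vector s.
  have t0 : 0 <= r / (2 * k) by rewrite divr_ge0 ?mulr_ge0 // ltW.
  pose zh : pd := (z.1 - (r / (2 * k)) *: col_mx u 0, z.2).
  have : gapz z zh <= r * rhoz r z.
    apply: (gap_le_rho b c l_gt0 le_la A_le) => //.
      (* There is room for the move: [r / (2 k)] is at most [1 / (2 mu)], a lower bound for the
         basic entries of [z]. *)
      move=> i; rewrite /= mxE [X in _ + X]mxE [X in _ - X]mxE.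
      case: (split_ordP i) => j ->; last by rewrite col_mxEd mxE mulr0 subr0 z0.
      rewrite col_mxEu subr_ge0; apply: le_trans (basic_pos j zt).
      have : u j 0 <= 1.
        by apply: le_trans (ler_norm _) _; apply: le_trans (norm2_coord _ _) u1.
      have : r / (2 * k) <= (2 * mu)^-1.
        rewrite ler_pdivrMr ?mulr_gt0 //; apply: le_trans r_le _.
        rewrite (_ : (2 * mu)^-1 * (2 * k) = k / mu); last by field; rewrite gt_eqF.
        rewrite invfM ler_pM2r ?invr_gt0 //; apply: le_trans k_ge1.
        by rewrite invf_le1.
      by move=> h1 h2; apply: le_trans h1; rewrite ler_piMr.
    rewrite normME; apply: le_trans (pnorm_le l_gt0 le_la A_le sqr_sgnN1 _) _ => /=.
    rewrite subrr norm20 mulr0 addr0 addrAC subrr add0r norm2N norm2Z ger0_norm //.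
    rewrite mulrA (_ : 2 * k * _ = r); last by field; rewrite !gt_eqF.
    rewrite ler_piMr //; apply: le_trans (norm2_col_mx_le _ _) _.
    by rewrite norm20 addr0.
  rewrite gapE /= subrr dotp0r sub0r addrAC subrr add0r dotpNr opprK dotpZr.
  rewrite -[slack z]vsubmxK dotp_col_mx dotp0r addr0 ru.
  rewrite [X in X <= _ -> _]mulrAC ler_pdivrMr ?mulr_gt0 //.
  by rewrite -[X in _ <= X -> _]mulrA ler_pM2l // [X in _ <= X -> _]mulrC.
have xB : norm2 (z.1 - xs) <= S * norm2 (A *m (z.1 - xs)).
  have -> : z.1 - xs = col_mx (usubmx (z.1 - xs)) 0.
    rewrite -[LHS]vsubmxK; congr col_mx; apply/matrixP => i j.
    by rewrite !mxE ord1 zN0 xs_eq0 subr0.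
  apply: le_trans (norm2_col_mx_le _ _) _; rewrite norm20 addr0.
  by rewrite mulmx_basis mulmx0 addr0 -{1}[usubmx _](mulKmx Bu) BS.
have yB : norm2 (z.2 - ys) <= S * norm2 s.
  have -> : z.2 - ys = - ((invmx B)^T *m s).
    by rewrite /s slack_basic trmx_inv mulmxN mulKmx ?unitmx_tr // opprK.
  by rewrite norm2N norm2_trmx_bound.
apply: le_trans (pnorm_le l_gt0 le_la A_le sqr_sgn1 _) _ => /=.
(* The two contributions combine through [a = k * k * l]. *)
have -> : 8 * (S * a) * rhoz r z =
    2 * k * (S * (2 * k * l * rhoz r z) + l * (S * (2 * k * rhoz r z))).
  have aE : a = k * k * l by rewrite kK divfK ?gt_eqF.
  by rewrite [X in S * X]aE; ring.
rewrite ler_pM2l ?mulr_gt0 //; apply: lerD.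
  by apply: le_trans xB _; rewrite ler_wpM2l.
by rewrite ler_pM2l //; apply: le_trans yB _; rewrite ler_wpM2l.
Qed.

(** * Counting loops and iterations *)

Section Complexity.
Variables (beta F : R) (j0 : nat).
Let S := spectral_norm (invmx B).
Hypotheses (FE : F = kap * (W * mu)) (beta_gt0 : 0 < beta)
  (beta_le1 : beta <= 1) (Ac0 : A *m c = 0)
  (j0_large : 4096 * F ^+ 2 * beta ^+ j0 <= 1) (W_gt0 : 0 < W)
  (xs_opt : primal_optimal A b c xs) (ss_opt : dual_optimal A b c (ys, ss))
  (supp_xs : pos_support xs = [set i : 'I_(m + p) | (i < m)%N]%SET).
Local Notation run := (rPDHG_run A b c tau sigma beta).
Local Notation G := (32 * (16 * F) / beta + 1).
Local Notation Gloc := (32 * (8 * (S * a)) / beta + 1).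

Let F_gt0 : 0 < F. Proof. by rewrite FE !mulr_gt0 ?invr_gt0. Qed.
Let F_ge0 : 0 <= F. Proof. exact: ltW. Qed.
Let P_le : pn zs <= 2 * k * W. Proof. exact: pnorm_optimal. Qed.
Let sharp z r : nonneg z.1 -> 0 < r -> r <= 4 * (2 * k * W) ->
  pn (z - zs) <= 2 * k * W -> pn (z - zs) <= 16 * F * rhoz r z.
Proof.
move=> z0 r_gt0 r_le; rewrite FE; apply: pnorm_le_rho => //.
by apply: le_trans r_le _; rewrite le_eqVlt; apply/orP; left; apply/eqP; ring.
Qed.
Let run_succ' t zp z T := @run_succ _ _ _ A b c a l beta (2 * k * W) zs l_gt0 le_la
  A_le beta_gt0 xs_ge0 gap_optimal_ge0 P_le t zp z T.
Let run_dist' t zp z T := @run_dist _ _ _ A b c a l beta (2 * k * W) zs l_gt0 le_la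
  A_le xs_ge0 gap_optimal_ge0 P_le t zp z T.

(** After [j0] decay factors the bound of [run_kkt_dist] falls below [1 / mu], because
    [W * mu <= F]. *)
Lemma j0_decay : 512 * F * W * beta ^+ j0 <= mu^-1.
Proof.
have b0 : 0 < beta ^+ j0 by rewrite exprn_gt0.
rewrite -(ler_pM2l (mulr_gt0 F_gt0 mu_gt0)).
have -> : F * mu / mu = F by rewrite mulfK ?gt_eqF.
apply: le_trans (_ : F * W * mu / (8 * F) <= _).
  have -> : F * mu * (512 * F * W * beta ^+ j0) =
      F * W * mu / (8 * F) * (4096 * F ^+ 2 * beta ^+ j0).
    by field; rewrite gt_eqF.
  by rewrite ler_piMr // divr_ge0 ?mulr_ge0 // ltW.
rewrite (_ : F * W * mu / (8 * F) = W * mu / 8); last by field; rewrite gt_eqF.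
have : W * mu <= F by rewrite FE ler_peMl ?mulr_ge0 // ltW.
have : 0 < W * mu by rewrite mulr_gt0.
lra.
Qed.

Lemma run_kkt_dist t zp z T : run t.+1 zp z T ->
  kkt_dist z <= 512 * F * W * beta ^+ t.
Proof.
move=> run_t; have [r_gt0 r_le _ rho_le] := run_succ' run_t.
have [z0 zP] := run_dist' run_t.
have [zp0 zpP] : nonneg zp.1 /\ pn (zp - zs) <= 2 * k * W.
  by have [? [? run_zp]] := run_pred run_t; exact: run_dist' run_zp.
apply: le_trans (kkt_dist_le_rho z0 r_gt0 _ zP) _.
  by apply: le_trans r_le _; lra.
have -> : 512 * F * W * beta ^+ t =
    8 * k * (W * mu) * (32 * (2 * k * W) * beta ^+ t).
  by rewrite FE -[X in 512 * (X * _)]kK; ring.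
by rewrite ler_wpM2l // !mulr_ge0 ?(ltW mu_gt0) ?(ltW k_gt0).
Qed.

Lemma run_close t zp z T : run t zp z T -> (j0 < t)%N ->
  pn (z - zs) <= (4 * k * mu)^-1.
Proof.
case: t => // t run_t; rewrite ltnS => j0t.
have [r_gt0 r_le _ rho_le] := run_succ' run_t; have [z0 zP] := run_dist' run_t.
have [zp0 zpP] : nonneg zp.1 /\ pn (zp - zs) <= 2 * k * W.
  by have [? [? run_zp]] := run_pred run_t; exact: run_dist' run_zp.
apply: le_trans (sharp z0 r_gt0 _ zP) _; first by lra.
apply: (@le_trans _ _ (16 * F * (32 * (2 * k * W) * beta ^+ j0))).
  rewrite ler_wpM2l ?mulr_ge0 //; apply: le_trans rho_le _.
  by rewrite ler_wpM2l ?mulr_ge0 ?(ltW k_gt0) // ler_wiXn2l // ltW.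
rewrite -[leRHS]mul1r ler_pdivlMr ?mulr_gt0 //; apply: le_trans j0_large.
(* The factors multiply to [4096 F ^ 2], which is the origin of the constant in [j0_large]. *)
have -> : 16 * F * (32 * (2 * k * W) * beta ^+ j0) * (4 * k * mu) =
    4096 * F * (k * k * (W * mu)) * beta ^+ j0 by ring.
by rewrite kK -FE expr2 mulrA.
Qed.

(** The start [zp] of the loop is close, its iterates stay close, and each averaged point results
    from a step that clips the coordinate. The start is not averaged, so one loop beyond closeness
    is enough. *)
Lemma run_nonbasic_eq0 t zp z T j : run t zp z T -> (j0.+1 < t)%N ->
  z.1 (rshift m j) 0 = 0.
Proof.
move=> H; case: H => [//|{}t zpp {}zp {}T q run_t _ _]; rewrite ltnS => j0t.
have zp_close := run_close run_t j0t.
rewrite /average /= mxE (raddf_sum fst) summxE big_nat big1 ?mulr0 // => -[//|i] _.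
apply: step_nonbasic_eq0; apply: le_trans zp_close.
exact: (iter_dist (zs := zs) l_gt0 le_la A_le xs_ge0 gap_optimal_ge0).
Qed.

Lemma run_basis t zp z T : run t zp z T -> (j0.+1 < t)%N ->
  pos_support z.1 = pos_support xs.
Proof.
move=> run_t j0t; rewrite supp_xs; apply/setP => i; rewrite !inE.
case: (split_ordP i) => j -> /=.
  apply: lt_le_trans (basic_pos j (run_close run_t (ltnW j0t))).
  by rewrite invr_gt0 mulr_gt0.
by rewrite (run_nonbasic_eq0 j run_t j0t) ltxx.
Qed.

(** The preceding start [zp] is close as well, and the displacement is at most four times its
    distance, so the radius fits [local_pnorm_le_rho]. *)
Lemma run_local t zp z T : (j0.+1 < t)%N -> run t zp z T ->
  pn (z - zs) <= 8 * (S * a) * rhoz (nM (z - zp)) z.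
Proof.
case: t => // t j0t run_t.
have [r_gt0 r_le _ _] := run_succ' run_t; have [z0 _] := run_dist' run_t.
apply: local_pnorm_le_rho => //.
- apply: le_trans r_le _.
  have : pn (zp - zs) <= (4 * k * mu)^-1.
    by have [? [? run_zp]] := run_pred run_t; exact: run_close run_zp j0t.
  have -> : (k * mu)^-1 = 4 * (4 * k * mu)^-1.
    by field; rewrite !gt_eqF.
  by rewrite ler_pM2l.
- exact: run_close run_t (ltnW j0t).
- by move=> j; apply: run_nonbasic_eq0 run_t j0t.
- exact: spectral_norm_ge0.
- exact: norm2_mulmx_spectral.
Qed.

Let G_ge0 : 0 <= G. Proof. by rewrite addr_ge0 ?divr_ge0 ?mulr_ge0 // ltW. Qed.
Let Sa_ge0 : 0 <= 8 * (S * a).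
Proof. by rewrite !mulr_ge0 ?spectral_norm_ge0 // ltW. Qed.
Let Gloc_ge0 : 0 <= Gloc.
Proof. by rewrite addr_ge0 // divr_ge0 ?(ltW beta_gt0) // (mulr_ge0 _ Sa_ge0). Qed.
Let L_ge0 : 0 <= 16 * F. Proof. by rewrite mulr_ge0. Qed.

Lemma run_length_bound t j zp z T : run t zp z T -> (t <= j0.+2 + j)%N ->
  T%:R <= j0.+2%:R * G + j%:R * Gloc.
Proof.
move=> run_t tj; have [j0t|tj0] := ltnP j0.+1 t.
  apply: le_trans (run_length_local (zs := zs) l_gt0 le_la A_le beta_gt0 xs_ge0
    gap_optimal_ge0 P_le L_ge0 sharp Sa_ge0 run_local run_t j0t) _.
  by rewrite lerD2l ler_wpM2r // ler_nat leq_subLR.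
apply: le_trans (run_length (zs := zs) l_gt0 le_la A_le beta_gt0 xs_ge0
  gap_optimal_ge0 P_le L_ge0 sharp run_t) _.
rewrite -[leLHS]addr0 lerD ?mulr_ge0 // ler_wpM2r // ler_nat.
exact: leqW.
Qed.

Let run_exists' := run_exists (zs := zs) l_gt0 le_la A_le beta_gt0 xs_ge0
    gap_optimal_ge0 P_le L_ge0 sharp.

Lemma first_basis_iterate_bound : exists N1 T1,
  first_basis_iterate A b c tau sigma beta (pos_support xs) N1 T1 /\
  T1%:R <= j0.+2%:R * G.
Proof.
pose Q N := `[< basis_identified_from A b c tau sigma beta (pos_support xs) N >].
have Q2 : Q j0.+2.
  by apply/asboolP => q z T j0q [zp run_t]; apply: run_basis run_t j0q.
have exQ : exists N, Q N by exists j0.+2.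
case: (ex_minnP exQ) => N1 /asboolP QN1 minN1.
case: (run_exists' N1) => [[zp [z [T run_N]]]|].
  exists N1, T; split.
    split; first by exists z, zp.
    by split=> // q qN1 /asboolP /minN1; rewrite leqNgt qN1.
  have := run_length_bound (j := 0) run_N; rewrite mul0r addr0; apply.
  by rewrite addn0 minN1.
case=> t [zp [z [T [tN run_t sz]]]].
(* A run that ends before [N1] ends at the optimal point with no iterate after it, so the basis is
   identified from there on, against the minimality of [N1]. *)
have /asboolP /minN1 : basis_identified_from A b c tau sigma beta (pos_support xs) t.
  move=> q z' T' tq [zp' run_q].
  by rewrite (run_after_saddle run_t sz run_q tq) (saddle_unique sz).
by rewrite leqNgt tN.
Qed.

Lemma kkt_dist_eps_optimal eps z : kkt_dist z <= eps ->
  outer_eps_optimal A b c eps z.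
Proof.
move=> z_eps; apply: le_trans z_eps.
apply: le_trans (norm2_col_mx_le (z.1 - xs) (slack z - ss)).
apply: ge_inf; first by exists 0 => _ [w _ <-]; exact: norm2_ge0.
by exists (xs, ss) => //; split=> //; exists ys.
Qed.

Lemma first_eps_iterate_bound eps j : 0 < eps -> beta ^+ j / mu <= eps ->
  exists N2 T2, first_eps_iterate A b c tau sigma beta eps N2 T2 /\
  T2%:R <= j0.+2%:R * G + j%:R * Gloc.
Proof.
move=> eps_gt0 j_eps.
pose Q N := `[< exists z T, outer_iterate A b c tau sigma beta N z T /\
  outer_eps_optimal A b c eps z >].
have [q q_le Qq] : exists2 N, (N <= j0.+2 + j)%N & Q N.
  case: (run_exists' (j0.+2 + j)) => [[zp [z [T run_N]]]|].
    exists (j0.+2 + j)%N => //; apply/asboolP; exists z, T; split; first by exists zp.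
    apply: kkt_dist_eps_optimal; apply: le_trans j_eps.
    (* Of the decay factors, [j0] bring the bound below [1 / mu], [j] more reach [eps], and one is
       spare. *)
    apply: le_trans (run_kkt_dist run_N) _; rewrite exprS exprD mulrCA.
    apply: (@le_trans _ _ (512 * F * W * (beta ^+ j0 * beta ^+ j))).
      rewrite ler_piMl //; have b0 := ltW beta_gt0.
      exact: mulr_ge0 (mulr_ge0 (mulr_ge0 (ler0n _ 512) F_ge0) (ltW W_gt0))
        (mulr_ge0 (exprn_ge0 _ b0) (exprn_ge0 _ b0)).
    by rewrite mulrA mulrC ler_wpM2l ?exprn_ge0 ?j0_decay // ltW.
  case=> t [zp [z [T [tN run_t sz]]]]; exists t; first exact: ltnW.
  apply/asboolP; exists z, T; split; first by exists zp.
  apply: kkt_dist_eps_optimal; rewrite (saddle_unique sz) /kkt_dist subrr norm20.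
  by rewrite slack_dist subrr mulmx0 oppr0 norm20 addr0 ltW.
have exQ : exists N, Q N by exists q.
case: (ex_minnP exQ) => N2 /asboolP [z [T [[zp run_t] z_opt]]] minN2.
exists N2, T; split.
  split; first by exists z; split=> //; exists zp.
  move=> M z' T' MN2 outM optM; have /minN2 : Q M by apply/asboolP; exists z', T'.
  by rewrite leqNgt MN2.
by apply: run_length_bound run_t _; apply: leq_trans q_le; apply: minN2.
Qed.

End Complexity.

End Local.
End Sharpness.

(** * The complexity bounds *)

Section Constants.
Context {R : realType}.

Lemma expR1V_pow t : (expR 1 : R)^-1 ^+ t = expR (- t%:R).
Proof. by rewrite exprVn -expRM_natl mulr1 expRN. Qed.

Lemma decay_index (F : R) : 2 <= F -> exists j0 : nat,
  j0%:R <= 14 * ln F + 1 /\ 4096 * F ^+ 2 * (expR 1)^-1 ^+ j0 <= 1.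
Proof.
move=> F2; have F_gt0 : 0 < F by apply: lt_le_trans F2.
have x_ge0 : 0 <= 14 * ln F.
  by rewrite mulr_ge0 // ln_ge0 //; apply: le_trans F2; rewrite ler1n.
have /andP [x_le x_lt] := truncn_itv x_ge0.
exists (Num.truncn (14 * ln F)).+1; split; first by rewrite -natr1 lerD2r.
rewrite expR1V_pow expRN ler_pdivrMr ?expR_gt0 // mul1r.
(* As [2 <= F], the product is at most [F ^ 14]; hence the factor [14] in front of [ln F]. *)
have -> : 4096 * F ^+ 2 = 2 ^+ 12 * F ^+ 2 by ring.
apply: (@le_trans _ _ (F ^+ 14)).
  by rewrite -[14%N]/(12 + 2)%N exprD ler_wpM2r ?exprn_ge0 ?lerXn2r ?nnegrE // ltW.
rewrite -[X in X ^+ 14](lnK _) ?posrE // -expRM_natl.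
by rewrite ler_expR ltW.
Qed.

(** [B v = A (v; 0)] gives [|v| <= |B^-1| |A| |v|]. The bound absorbs the additive [1] in the length
    of a local loop. *)
Lemma basis_cond_ge1 (m p : nat) (A : 'M[R]_(m, m + p)) : (0 < m)%N ->
  basis_mx A \in unitmx ->
  1 <= spectral_norm (invmx (basis_mx A)) * spectral_norm A.
Proof.
case: m A => // m A _ Bu; pose v : 'cV[R]_m.+1 := delta_mx 0 0.
have v0 : v != 0.
  by apply/eqP => /matrixP /(_ 0 0); rewrite !mxE eqxx; apply/eqP; exact: oner_neq0.
rewrite -(ler_pM2r (norm2_gt0 v0)) mul1r -{1}(mulKmx Bu v) -mulrA.
apply: le_trans (norm2_mulmx_spectral _ _) _.
rewrite ler_wpM2l ?spectral_norm_ge0 //.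
have -> : basis_mx A *m v = A *m col_mx v 0 by rewrite mulmx_basis mulmx0 addr0.
apply: le_trans (norm2_mulmx_spectral _ _) _.
rewrite ler_wpM2l ?spectral_norm_ge0 //.
by apply: le_trans (norm2_col_mx_le _ _) _; rewrite norm20 addr0.
Qed.

(** [mu] is the maximum in [Phi]. The square roots are at least [1], so both [|xs|_1] and [|ss|_1]
    are at least [1 / mu]; the resulting bound [2] keeps the logarithm away from zero. *)
Lemma Phi_bounds (m p : nat) (A : 'M[R]_(m, m + p)) (xs ss : 'cV[R]_(m + p)) :
  (0 < m)%N -> (0 < p)%N ->
  (forall i, 0 < xs (lshift p i) 0) -> (forall j, 0 < ss (rshift m j) 0) ->
  let D := invmx (basis_mx A) *m nonbasis_mx A in
  exists mu : R, [/\ 0 < mu, Phi A xs ss = (norm1 xs + norm1 ss) * mu,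
    2 <= (norm1 xs + norm1 ss) * mu,
    forall i, Num.sqrt (norm2 (row i D) ^+ 2 + 1) <= mu * xs (lshift p i) 0 /\
      1 <= mu * xs (lshift p i) 0
  & forall j, Num.sqrt (norm2 (col j D) ^+ 2 + 1) <= mu * ss (rshift m j) 0 /\
      1 <= mu * ss (rshift m j) 0].
Proof.
move=> m_gt0 p_gt0 xs_gt0 ss_gt0 D.
have sqrt_ge1 (x : R) : 1 <= Num.sqrt (x ^+ 2 + 1).
  by rewrite -[leLHS]sqrtr1 ler_sqrt ?addr_ge0 ?sqr_ge0 // lerDr sqr_ge0.
set mu1 := \big[Num.max/0]_(j < p)
  (Num.sqrt (norm2 (col j D) ^+ 2 + 1) / ss (rshift m j) 0).
set mu2 := \big[Num.max/0]_(i < m)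
  (Num.sqrt (norm2 (row i D) ^+ 2 + 1) / xs (lshift p i) 0).
have row_le i :
    Num.sqrt (norm2 (row i D) ^+ 2 + 1) <= Num.max mu1 mu2 * xs (lshift p i) 0.
  rewrite -ler_pdivrMr // le_max; apply/orP; right.
  exact: (le_bigmax 0 (fun i => Num.sqrt (norm2 (row i D) ^+ 2 + 1) / xs (lshift p i) 0)).
have col_le j :
    Num.sqrt (norm2 (col j D) ^+ 2 + 1) <= Num.max mu1 mu2 * ss (rshift m j) 0.
  rewrite -ler_pdivrMr // le_max; apply/orP; left.
  exact: (le_bigmax 0 (fun j => Num.sqrt (norm2 (col j D) ^+ 2 + 1) / ss (rshift m j) 0)).
exists (Num.max mu1 mu2).
pose i0 := Ordinal m_gt0; pose j0 := Ordinal p_gt0.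
have xi0 := le_trans (sqrt_ge1 _) (row_le i0).
have sj0 := le_trans (sqrt_ge1 _) (col_le j0).
have mu_gt0 : 0 < Num.max mu1 mu2.
  by rewrite -(pmulr_lgt0 _ (xs_gt0 i0)); apply: lt_le_trans xi0.
split=> //; last 2 first.
- by move=> i; split=> //; exact: le_trans (row_le i).
- by move=> j; split=> //; exact: le_trans (col_le j).
rewrite mulrC mulrDr -[leLHS]/(1 + 1); apply: lerD.
- apply: le_trans xi0 _; rewrite ler_pM2l // /norm1 (bigD1 (lshift p i0)) //=.
  by rewrite -[leLHS]addr0 lerD ?ler_norm ?sumr_ge0.
- apply: le_trans sj0 _; rewrite ler_pM2l // /norm1 (bigD1 (rshift m j0)) //=.
  by rewrite -[leLHS]addr0 lerD ?ler_norm ?sumr_ge0.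
Qed.

(** The local phase starts at accuracy [1 / mu]; this comparison expresses its logarithm through
    [min_xs]. *)
Lemma min_xs_ge (m p : nat) (xs ss : 'cV[R]_(m + p)) (mu : R) :
  (0 < m)%N -> 0 < mu ->
  (forall i, 1 <= mu * xs (lshift p i) 0 /\ ss (lshift p i) 0 = 0) ->
  (forall j, xs (rshift m j) 0 = 0 /\ 1 <= mu * ss (rshift m j) 0) ->
  mu^-1 <= min_xs xs ss.
Proof.
move=> m_gt0 mu_gt0 HB HN; apply: lb_le_inf.
  pose i0 := lshift p (Ordinal m_gt0).
  by exists (xs i0 0 + ss i0 0), i0.
move=> _ [i _ <-]; rewrite -[mu^-1]mulr1 ler_pdivrMl //.
case: (split_ordP i) => j ->.
  by have [? ->] := HB j; rewrite addr0.
by have [-> ?] := HN j; rewrite add0r.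
Qed.

End Constants.

Theorem theorem4p1 (R : realType) :
  exists C1 C2 : R, 0 < C1 /\ 0 < C2 /\
  forall (m p : nat) (A : 'M[R]_(m, m + p)) (b : 'cV[R]_m)
    (c : 'cV[R]_(m + p)) (xs ss : 'cV[R]_(m + p)) (ys : 'cV[R]_m),
  (1 <= m)%N -> (1 <= p)%N -> row_free A ->
  unique_primal_optimal A b c xs ->
  unique_dual_optimal A b c (ys, ss) ->
  pos_support xs = [set i : 'I_(m + p) | (i < m)%N]%SET ->
  A *m c = 0 ->
  let tau := (2 * kappa A)^-1 in
  let sigma := (2 * lambda_max A * lambda_min A)^-1 in
  let beta := (expR 1)^-1 in
  exists Tbasis : R,
    0 <= Tbasis <= C1 * (kappa A * Phi A xs ss * ln (kappa A * Phi A xs ss)) /\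
    (exists N1 T1 : nat,
       first_basis_iterate A b c tau sigma beta (pos_support xs) N1 T1 /\
       T1%:R <= Tbasis) /\
    forall eps : R, 0 < eps ->
    exists Tlocal : R,
      0 <= Tlocal <=
        C2 * (spectral_norm (invmx (basis_mx A)) * spectral_norm A *
              Num.max 0 (ln (min_xs xs ss / eps))) /\
      exists N2 T2 : nat,
        first_eps_iterate A b c tau sigma beta eps N2 T2 /\
        T2%:R <= Tbasis + Tlocal.
Proof.
set E : R := expR 1; pose lam : R := ln 2.
have E_gt1 : 1 < E by rewrite /E expR_gt1 ltr01.
have E_gt0 : 0 < E by exact: expR_gt0.
have lam_gt0 : 0 < lam by rewrite ln_gt0 // ltr1n.
have lamV_gt0 : 0 < lam^-1 by rewrite invr_gt0.
have nat_gt0 q : 0 < q.+1%:R :> R by rewrite ltr0n.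
have C1_gt0 : 0 < E * (513 * (14 + 3 / lam) + 257 / lam).
  exact: (mulr_gt0 E_gt0 (addr_gt0 (mulr_gt0 (nat_gt0 512%N)
    (addr_gt0 (nat_gt0 13%N) (mulr_gt0 (nat_gt0 2%N) lamV_gt0)))
    (mulr_gt0 (nat_gt0 256%N) lamV_gt0))).
have C2_gt0 : 0 < 257 * E by exact: mulr_gt0 (nat_gt0 256%N) E_gt0.
(* [513 = 32 * 16 + 1] and [257 = 32 * 8 + 1] come from the two loop lengths, with [E = 1 / beta].
   The factor [14 + 3 / lam] bounds [j0 + 2] per unit of [ln F], and [257 / lam] pays for one local
   loop. *)
exists (E * (513 * (14 + 3 / lam) + 257 / lam)), (257 * E).
split; [exact: C1_gt0 | split; first exact: C2_gt0].
move=> m p A b c xs ss ys m_gt0 p_gt0 freeA xs_uniq ys_uniq xs_supp Ac0 tau sigma beta.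
have [Bu Axs ATys HB HN] := lp_structure xs_uniq ys_uniq xs_supp.
have xs_gt0 i := proj1 (HB i); have ss_eq0 i := proj2 (HB i).
have xs_eq0 j := proj1 (HN j); have ss_gt0 j := proj2 (HN j).
have [l_gt0 le_la A_le AT_ge a_le] := singular_bounds m_gt0 freeA.
have [mu [mu_gt0 PhiE Wmu_ge2 Hrow Hcol]] := Phi_bounds A m_gt0 p_gt0 xs_gt0 ss_gt0.
have row_le i := proj1 (Hrow i); have mu_basic i := proj2 (Hrow i).
have col_le j := proj1 (Hcol j); have mu_nonbasic j := proj2 (Hcol j).
set a := lambda_max A in le_la A_le a_le *; set l := lambda_min A in l_gt0 le_la AT_ge *.
have a_gt0 : 0 < a by exact: lt_le_trans le_la.
set W := norm1 xs + norm1 ss in PhiE Wmu_ge2.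
have W_gt0 : 0 < W by rewrite -(pmulr_lgt0 _ mu_gt0); apply: lt_le_trans Wmu_ge2.
have aE : spectral_norm A = a.
  by apply/eqP; rewrite eq_le a_le andbT spectral_norm_le // ltW.
set S := spectral_norm (invmx (basis_mx A)).
set F := kappa A * Phi A xs ss.
have FE : F = a / l * (W * mu) by rewrite /F PhiE.
move: F FE => F FE.
have F_ge2 : 2 <= F.
  apply: le_trans Wmu_ge2 _; rewrite FE ler_peMl ?mulr_ge0 ?(ltW mu_gt0) ?(ltW W_gt0) //.
  by rewrite ler_pdivlMr // mul1r.
have F_gt0 : 0 < F by apply: lt_le_trans F_ge2.
have H_ge1 : 1 <= S * a by rewrite -aE basis_cond_ge1.
(* This comparison allows one local loop to be charged to [Tbasis]. *)
have H_le : S * a <= F.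
  rewrite FE (_ : a / l * (W * mu) = W * mu / l * a); last by ring.
  rewrite ler_pM2r // spectral_norm_le //.
    by rewrite divr_ge0 ?mulr_ge0 ?(ltW mu_gt0) ?(ltW W_gt0) ?(ltW l_gt0).
  exact: (norm2_basis_inv ss l_gt0 AT_ge Bu xs_gt0 mu_gt0 row_le).
have x_ge : lam <= ln F by rewrite ler_ln ?posrE.
have [j0 [j0_le j0_large]] := decay_index F_ge2.
have beta_gt0 : 0 < beta by rewrite invr_gt0.
have beta_le1 : beta <= 1 by rewrite invf_le1 // ltW.
set x := ln F in x_ge j0_le *.
have x_gt0 : 0 < x by exact: lt_le_trans x_ge.
set G := 32 * (16 * F) / beta + 1; set Gl := 32 * (8 * (S * a)) / beta + 1.
have x_ge1 : 1 <= x / lam by rewrite ler_pdivlMr ?mul1r.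
have G_le : G <= 513 * (F * E).
  have : 1 <= F * E by rewrite mulr_ege1 ?(ltW E_gt1) // (le_trans _ F_ge2) // ler1n.
  by rewrite /G /beta invrK => h; lra.
have Gl_le : Gl <= 257 * (S * a * E).
  have : 1 <= S * a * E by rewrite mulr_ege1 ?(ltW E_gt1).
  by rewrite /Gl /beta invrK => h; lra.
have G_ge0 : 0 <= G by rewrite addr_ge0 // divr_ge0 ?mulr_ge0 ?(ltW F_gt0) // ltW.
have N2G_le : j0.+2%:R * G <= E * (513 * (14 + 3 / lam)) * (F * x).
  have j_le : j0.+2%:R <= (14 + 3 / lam) * x by rewrite -!natr1; lra.
  apply: le_trans (ler_pM _ G_ge0 j_le G_le) _ => //.
  by rewrite le_eqVlt; apply/orP; left; apply/eqP; ring.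
have Gl_le' : Gl <= E * (257 / lam) * (F * x).
  apply: le_trans Gl_le _.
  have -> : E * (257 / lam) * (F * x) = 257 * (F * E * (x / lam)) by ring.
  rewrite (ler_pM2l (nat_gt0 256%N)); apply: (@le_trans _ _ (F * E)); first by rewrite ler_pM2r.
  by rewrite ler_peMr // mulr_ge0 // ltW.
have H_ge0 : 0 <= S * a by exact: le_trans H_ge1.
have Gl_ge0 : 0 <= Gl.
  by rewrite addr_ge0 // divr_ge0 ?(ltW beta_gt0) // mulr_ge0 // mulr_ge0.
have Tbasis_ge : j0.+2%:R * G + Gl <=
    E * (513 * (14 + 3 / lam) + 257 / lam) * (F * x).
  by apply: le_trans (lerD N2G_le Gl_le') _; rewrite -mulrDl -mulrDr.
exists (E * (513 * (14 + 3 / lam) + 257 / lam) * (F * x)); split; last split.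
- by rewrite lexx andbT; apply: le_trans Tbasis_ge; rewrite addr_ge0 ?mulr_ge0.
- have [N1 [T1 [HN1 HT1]]] := first_basis_iterate_bound l_gt0 le_la A_le AT_ge Bu
    Axs ATys xs_gt0 ss_eq0 xs_eq0 ss_gt0 mu_gt0 row_le col_le mu_basic mu_nonbasic
    FE beta_gt0 beta_le1 Ac0 j0_large W_gt0 xs_supp.
  exists N1, T1; split; first exact: HN1.
  by apply: le_trans HT1 _; apply: le_trans Tbasis_ge; rewrite lerDl.
move=> eps eps_gt0; rewrite aE; set v := Num.max 0 _.
have v_ge0 : 0 <= v by rewrite le_max lexx.
exists (257 * E * (S * a * v)); split.
  rewrite lexx andbT; apply: mulr_ge0 (mulr_ge0 H_ge0 v_ge0).
  exact: ltW.
have /andP [v_le v_lt] := truncn_itv v_ge0.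
(* Rounding up costs one extra local loop. It cannot be charged to [Tlocal], which vanishes for
   [v = 0], so [Tbasis] covers it. *)
set j := (Num.truncn v).+1 in v_lt *.
have min_ge : mu^-1 <= min_xs xs ss by exact: min_xs_ge.
have min_gt0 : 0 < min_xs xs ss by apply: lt_le_trans min_ge; rewrite invr_gt0.
have j_eps : beta ^+ j / mu <= eps.
  rewrite expR1V_pow; apply: (@le_trans _ _ (eps / min_xs xs ss / mu)).
    rewrite ler_pM2r ?invr_gt0 // -[leRHS]lnK ?posrE ?divr_gt0 // ler_expR.
    rewrite -[eps / _]invf_div lnV ?posrE ?divr_gt0 // lerN2.
    by apply: le_trans (ltW v_lt); rewrite le_max lexx orbT.
  by rewrite mulrAC ler_pdivrMr // ler_pM2l.
have [N2 [T2 [HN2 HT2]]] := first_eps_iterate_bound l_gt0 le_la A_le AT_ge Bu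
    Axs ATys xs_gt0 ss_eq0 xs_eq0 ss_gt0 mu_gt0 row_le col_le mu_basic mu_nonbasic
    FE beta_gt0 beta_le1 Ac0 j0_large W_gt0 (proj1 xs_uniq) (proj1 ys_uniq) eps_gt0 j_eps.
exists N2, T2; split; first exact: HN2.
apply: le_trans HT2 _; rewrite -/G -/Gl.
have jGl : j%:R * Gl <= v * Gl + Gl.
  have : j%:R <= v + 1 by rewrite -natr1 lerD2r.
  by move/(ler_wpM2r Gl_ge0); rewrite mulrDl mul1r.
have vGl : v * Gl <= 257 * E * (S * a * v).
  have -> : 257 * E * (S * a * v) = v * (257 * (S * a * E)) by ring.
  by rewrite ler_wpM2l.
apply: (le_trans (lerD (lexx _) jGl)).
by rewrite [v * Gl + Gl]addrC addrA; exact: lerD.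
Qed.
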